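(* The variety of complex $3$-dimensional binary $\mathfrak{perm}$ superalgebras of type $(2,1)$ has dimension $4$ and has exactly $7$ irreducible components: $\overline{\mathcal{O}(\mathbf{R}_{01})},\ \overline{\mathcal{O}(\mathbf{R}_{02})},\ \overline{\mathcal{O}(\mathbf{R}_{04})},\ \overline{\mathcal{O}(\mathbf{R}_{10})},\ \overline{\mathcal{O}(\mathbf{R}_{25})},\ \overline{\mathcal{O}(\mathbf{R}_{31})},\ \overline{\mathcal{O}(\mathbf{R}_{33})}$. In particular, exactly $7$ superalgebras are rigid in this variety.
   Context: All algebras are over $\mathbb{C}$. A superalgebra is a $\mathbb{Z}_2$-graded algebra $A=A_0\oplus A_1$ with $A_iA_j\subseteq A_{i+j \bmod 2}$; $|x|\in\{0,1\}$ is the degree of a homogeneous $x$. It has type $(n,m)$ if $\dim A_0=n$, $\dim A_1=m$. The associator is $(x,y,z)=(xy)z-x(yz)$. A binary $\mathfrak{perm}$ superalgebra is a superalgebra satisfying, for all homogeneous $x,y,z$: $(x,y,z)=-(-1)^{|y||z|}(x,z,y)=-(-1)^{|x||y|}(y,x,z)$ and $(xy)z+(-1)^{|x||y|+|x||z|+|y||z|}(zy)x=(-1)^{|y||z|}(xz)y+(-1)^{|x||z|+|y||z|}(zx)y$. Geometric setting: fix a graded space $V=V_0\oplus V_1$ of type $(n,m)$ with a homogeneous basis. Superalgebra structures on $V$ are even bilinear maps $\mu:V\times V\to V$, identified with their structure constants; those satisfying a given family of graded polynomial identities form a Zariski-closed subset (an affine variety) of this affine space. The group $GL(V_0)\times GL(V_1)$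 acts by $(g*\mu)(x,y)=g\mu(g^{-1}x,g^{-1}y)$; its orbits are the isomorphism classes. $\mathcal{O}(A)$ denotes the orbit of (a structure representing) $A$ and $\overline{\mathcal{O}(A)}$ its Zariski closure. A superalgebra is rigid if its orbit is open in the variety. The dimension of the variety is the maximal dimension of its irreducible components. Superalgebras of type $(2,1)$, in basis $e_1,e_2$ (even), $f_1$ (odd), listed by nonzero products (unlisted products are zero): $\mathbf{R}_{01}$: $e_1e_1=e_1,\ e_2e_2=e_2$; $\mathbf{R}_{02}$: $e_1e_1=e_1,\ e_2e_2=e_2,\ e_1f_1=f_1,\ f_1e_1=f_1$; $\mathbf{R}_{04}$: $e_1e_1=e_1,\ e_2e_2=e_2,\ f_1e_1=f_1$; $\mathbf{R}_{10}$: $e_1e_1=e_1,\ f_1f_1=e_2$; $\mathbf{R}_{25}$: $e_1e_1=e_1,\ e_2e_1=e_2$; $\mathbf{R}_{31}$: $e_1e_1=e_1,\ e_2e_1=e_2,\ f_1e_1=f_1$; $\mathbf{R}_{33}$: $e_1e_1=e_1,\ e_2e_1=e_2,\ e_1f_1=f_1,\ f_1e_1=f_1$. *)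

(* Defs.v *)
From mathcomp Require Import all_boot all_algebra.
From mathcomp Require Import Rstruct complex.
Set Implicit Arguments. Unset Strict Implicit. Unset Printing Implicit Defensive.
Import GRing.Theory.
Local Open Scope ring_scope.

Definition CC : numClosedFieldType := Rdefinitions.R[i]%C.

(* The graded space V = V_0 (+) V_1 of type (2,1), basis indexed by 'I_3:
   0 = e1, 1 = e2 (even), 2 = f1 (odd). *)
Definition par (i : 'I_3) : bool := (val i == 2%N).

Definition vec := 'I_3 -> CC.

(* A (candidate) structure: structure constants c i j k = coefficient of the
   k-th basis vector in (b_i)(b_j).  A point of the affine space CC^27; the
   evenness condition is imposed as part of the variety below. *)
Definition struct := 'I_3 -> 'I_3 -> 'I_3 -> CC.

Definition even_struct (c : struct) : Prop :=
  forall i j k, par k != (par i (+) par j) -> c i j k = 0.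

Definition mul (c : struct) (u v : vec) : vec :=
  fun k => \sum_(i < 3) \sum_(j < 3) u i * v j * c i j k.

Definition vadd (u v : vec) : vec := fun k => u k + v k.
Definition vscale (a : CC) (u : vec) : vec := fun k => a * u k.

Definition homog (d : bool) (u : vec) : Prop := forall i, par i != d -> u i = 0.

Definition sgn (a b : bool) : CC := if a && b then -1 else 1.

Definition assoc (c : struct) (x y z : vec) : vec :=
  vadd (mul c (mul c x y) z) (vscale (-1) (mul c x (mul c y z))).

Definition perm_identities (c : struct) : Prop :=
  forall (a b d : bool) (x y z : vec), homog a x -> homog b y -> homog d z ->
    [/\ assoc c x y z = vscale (- sgn b d) (assoc c x z y),
        assoc c x y z = vscale (- sgn a b) (assoc c y x z) &
        vadd (mul c (mul c x y) z)
             (vscale (sgn a b * sgn a d * sgn b d) (mul c (mul c z y) x))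
        = vadd (vscale (sgn b d) (mul c (mul c x z) y))
               (vscale (sgn a d * sgn b d) (mul c (mul c z x) y))].

Definition PermVar (c : struct) : Prop := even_struct c /\ perm_identities c.

Definition sset := struct -> Prop.
Definition subs (A B : sset) : Prop := forall x, A x -> B x.
Definition seteq (A B : sset) : Prop := forall x, A x <-> B x.

Inductive polyfun : (struct -> CC) -> Prop :=
| pf_cst (a : CC) : polyfun (fun _ => a)
| pf_coord i j k : polyfun (fun c => c i j k)
| pf_add f g : polyfun f -> polyfun g -> polyfun (fun c => f c + g c)
| pf_mul f g : polyfun f -> polyfun g -> polyfun (fun c => f c * g c).

Definition zclosed (S : sset) : Prop :=
  exists P : (struct -> CC) -> Prop, (forall f, P f -> polyfun f) /\
    seteq S (fun c => forall f, P f -> f c = 0).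

Definition zclosure (S : sset) : sset :=
  fun x => forall T, zclosed T -> subs S T -> T x.

Definition zopen_in (X S : sset) : Prop :=
  exists T, zclosed T /\ seteq S (fun c => X c /\ ~ T c).

Definition irreducible_closed (Z : sset) : Prop :=
  [/\ zclosed Z, exists x, Z x &
      forall A B, zclosed A -> zclosed B -> subs Z (fun x => A x \/ B x) ->
        subs Z A \/ subs Z B].

Definition irr_component (X Z : sset) : Prop :=
  [/\ subs Z X, irreducible_closed Z &
      forall W, irreducible_closed W -> subs Z W -> subs W X -> subs W Z].

Definition irr_chain (S : sset) (n : nat) (Zs : nat -> sset) : Prop :=
  (forall i, (i <= n)%N -> irreducible_closed (Zs i) /\ subs (Zs i) S) /\
  (forall i, (i < n)%N -> subs (Zs i) (Zs i.+1) /\ ~ subs (Zs i.+1) (Zs i)).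

Definition krull_dim (S : sset) (n : nat) : Prop :=
  (exists Zs, irr_chain S n Zs) /\ ~ (exists Zs, irr_chain S n.+1 Zs).

Definition var_dim (X : sset) (n : nat) : Prop :=
  (exists Z, irr_component X Z /\ krull_dim Z n) /\
  (forall Z, irr_component X Z -> exists m, (m <= n)%N /\ krull_dim Z m).

Definition grp (g : 'M[CC]_3) : Prop :=
  g \in unitmx /\ forall i j, par i != par j -> g i j = 0.

Definition mapv (g : 'M[CC]_3) (v : vec) : vec := fun k => \sum_(l < 3) g k l * v l.

Definition basis (i : 'I_3) : vec := fun k => if k == i then 1 else 0.

Definition act (g : 'M[CC]_3) (c : struct) : struct :=
  fun i j => mapv g (mul c (mapv (invmx g) (basis i)) (mapv (invmx g) (basis j))).

Definition gorbit (c : struct) : sset := fun d => exists g, grp g /\ d = act g c.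

Definition rigid (X : sset) (c : struct) : Prop := X c /\ zopen_in X (gorbit c).

Definition mkS (l : seq (nat * nat * nat)) : struct :=
  fun i j k => if (val i, val j, val k) \in l then 1 else 0.

Definition R01 := mkS [:: (0,0,0); (1,1,1)]%N.
Definition R02 := mkS [:: (0,0,0); (1,1,1); (0,2,2); (2,0,2)]%N.
Definition R04 := mkS [:: (0,0,0); (1,1,1); (2,0,2)]%N.
Definition R10 := mkS [:: (0,0,0); (2,2,1)]%N.
Definition R25 := mkS [:: (0,0,0); (1,0,1)]%N.
Definition R31 := mkS [:: (0,0,0); (1,0,1); (2,0,2)]%N.
Definition R33 := mkS [:: (0,0,0); (1,0,1); (0,2,2); (2,0,2)]%N.

Definition Rlist : 'I_7 -> struct :=
  fun i => nth R01 [:: R01; R02; R04; R10; R25; R31; R33] (val i).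

(* Main.v *)
(* The even part of a structure is either [x y = l(y) x] for a functional [l], or
   commutative associative.  The latter means that a 3x2 matrix, linear in the
   structure constants, has rank at most 1; such products form an irreducible
   family whose general member is C x C.  If [f1 f1 = 0], the odd part amounts to a
   character [r] of the even part (the right action) together with a left action
   equal to 0 or [r]; if [f1 f1 <> 0], both actions vanish and [f1 f1] annihilates
   the even part.  This puts every structure in one of seven families, each of
   them a limit of structures in one orbit.

   Up to closure each of the seven orbits is the image of a polynomial map from the
   affine space A^4 that generically lands in the orbit, so its closure is irreducible.
   A chain of length 5 of irreducible closed sets in it would yield, for all N,
   N^5 linearly independent polynomials in 4 variables of degree O(N) in each
   variable, which is absurd.

   Explicit polynomials separate the orbit closures and cut out each orbit as an
   open set; they test commutativity, the odd actions, traces of multiplications,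
   and the discriminant of the trace form. *)

Require Import Defs.
From mathcomp Require Import all_boot all_algebra.
From mathcomp Require Import boolp ring zify.
(* MathComp shadows [Defs.mul]. *)
Require Import Defs.
Set Implicit Arguments. Unset Strict Implicit. Unset Printing Implicit Defensive.
Import GRing.Theory Num.Theory.
Local Open Scope ring_scope.

(* Keeps [/=] from unfolding [CC] to [complex], which breaks unification in big-operator lemmas. *)
Local Opaque CC.

(** * Zariski topology *)

Lemma sset_eq (A B : sset) : seteq A B -> A = B.
Proof. by move=> AB; apply/funext => x; apply/propext. Qed.

Lemma zclosure_closed S : zclosed (zclosure S).
Proof.
exists (fun f => polyfun f /\ forall x, S x -> f x = 0); split=> [f []//|x].
split=> [Sx f [pf f0]|Hx T [P [PP PT]] ST].
  apply: (Sx (fun x => f x = 0)) => //.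
  by exists (fun g => g = f); split=> [g ->//|y]; split=> [fy g ->//|]; apply.
by apply/PT => f Pf; apply: Hx; split=> [|y /ST/PT]; [apply: PP|apply].
Qed.

Lemma sub_zclosure S : subs S (zclosure S).
Proof. by move=> x Sx T _; apply. Qed.

Lemma zclosure_min S T : zclosed T -> subs S T -> subs (zclosure S) T.
Proof. by move=> cT ST x; apply. Qed.

Lemma zclosure_sub A B : subs A (zclosure B) -> subs (zclosure A) (zclosure B).
Proof. by move=> AB; apply: zclosure_min => //; apply: zclosure_closed. Qed.

Lemma zclosed_zero f : polyfun f -> zclosed (fun x => f x = 0).
Proof.
by move=> pf; exists (fun g => g = f); split=> [g ->//|y]; split=> [fy g ->//|]; apply.
Qed.

Lemma zclosed_zeros (I : Type) (f : I -> struct -> CC) :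
  (forall i, polyfun (f i)) -> zclosed (fun x => forall i, f i x = 0).
Proof.
move=> pf; exists (fun g => exists i, g = f i); split=> [g [i ->]//|x].
by split=> [fx g [i ->]//|h i]; apply: h; exists i.
Qed.

Lemma zclosure_zero S f x :
  polyfun f -> (forall y, S y -> f y = 0) -> zclosure S x -> f x = 0.
Proof. by move=> pf f0 /(_ (fun x => f x = 0)); apply => //; apply: zclosed_zero. Qed.

Lemma zclosed_nonzero Z x : zclosed Z -> ~ Z x ->
  exists f, [/\ polyfun f, forall y, Z y -> f y = 0 & f x != 0].
Proof.
move=> [P [PP PZ]] Zx.
have /existsNP[f /not_implyP[Pf /eqP fx]] : ~ forall f, P f -> f x = 0.
  by move/PZ.
by exists f; split=> // [|y /PZ]; [apply: PP|apply].
Qed.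

Lemma zclosedU A B : zclosed A -> zclosed B -> zclosed (fun x => A x \/ B x).
Proof.
move=> cA cB.
exists (fun h => polyfun h /\ forall x, A x \/ B x -> h x = 0); split=> [h []//|x].
split=> [ABx h [_]|H]; first exact.
apply: contrapT => /not_orP[Ax Bx].
have [f [pf f0 fx]] := zclosed_nonzero cA Ax.
have [g [pg g0 gx]] := zclosed_nonzero cB Bx.
have /eqP : f x * g x = 0.
  apply: (H (fun x => f x * g x)); split; first exact: pf_mul.
  by move=> y [/f0|/g0] ->; rewrite (mul0r, mulr0).
by rewrite mulf_eq0 (negbTE fx) (negbTE gx).
Qed.

Lemma polyfun_sum (I : Type) (r : seq I) (F : I -> struct -> CC) :
  (forall i, polyfun (F i)) -> polyfun (fun x => \sum_(i <- r) F i x).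
Proof.
move=> pF; elim: r => [|i r IH].
  by rewrite (_ : (fun _ => _) = fun _ => 0); [exact: pf_cst|apply/funext=> x; rewrite big_nil].
rewrite (_ : (fun _ => _) = fun x => F i x + \sum_(j <- r) F j x).
  exact: pf_add.
by apply/funext=> x; rewrite big_cons.
Qed.

Lemma polyfunX f k : polyfun f -> polyfun (fun x => f x ^+ k).
Proof.
move=> pf; elim: k => [|k IH]; first exact: pf_cst.
rewrite (_ : (fun _ => _) = fun x => f x * f x ^+ k); first exact: pf_mul.
by apply/funext=> x; rewrite exprS.
Qed.

Lemma irreducible_mul Z f g : irreducible_closed Z -> polyfun f -> polyfun g ->
  (forall x, Z x -> f x * g x = 0) ->
  (forall x, Z x -> f x = 0) \/ (forall x, Z x -> g x = 0).
Proof.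
move=> [_ _ irr] pf pg fg.
apply: (irr (fun x => f x = 0) (fun x => g x = 0)); try exact: zclosed_zero.
by move=> x /fg /eqP; rewrite mulf_eq0 => /orP[] /eqP; [left|right].
Qed.

(** * Polynomial maps from affine space *)

Inductive polp (n : nat) : ((nat -> CC) -> CC) -> Prop :=
| pp_cst (a : CC) : polp n (fun _ => a)
| pp_var i : (i < n)%N -> polp n (fun x => x i)
| pp_add f g : polp n f -> polp n g -> polp n (fun x => f x + g x)
| pp_mul f g : polp n f -> polp n g -> polp n (fun x => f x * g x).

Lemma pp_opp n f : polp n f -> polp n (fun x => - f x).
Proof.
move=> pf; rewrite (_ : (fun _ => _) = fun x => (-1) * f x).
  by apply: pp_mul => //; apply: pp_cst.
by apply/funext => x; rewrite mulN1r.
Qed.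

Lemma polp_line n f x y : polp n f ->
  exists p : {poly CC}, forall t, f (fun i => x i + t * (y i - x i)) = p.[t].
Proof.
elim=> [a|i _|g h _ [p gp] _ [q hq]|g h _ [p gp] _ [q hq]].
- by exists a%:P => t; rewrite hornerC.
- by exists ((x i)%:P + 'X * (y i - x i)%:P) => t; rewrite !hornerE.
- by exists (p + q) => t; rewrite hornerD gp hq.
- by exists (p * q) => t; rewrite hornerM gp hq.
Qed.

(** On the line through [x] and [y] both functions become univariate polynomials, nonzero because of
    their values at [t = 0] and [t = 1]. Their product is nonzero, so it has a non-root. *)
Lemma polp_domain n f g x y : polp n f -> polp n g ->
  f x != 0 -> g y != 0 -> exists z, f z * g z != 0.
Proof.
move=> pf pg fx gy.
have [p fp] := polp_line x y pf; have [q gq] := polp_line x y pg.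
have p0 : p != 0.
  apply: contraNneq fx => p0; move: (fp 0); rewrite p0 horner0 => <-.
  by apply/eqP; congr f; apply/funext=> i; rewrite mul0r addr0.
have q0 : q != 0.
  apply: contraNneq gy => q0; move: (gq 1); rewrite q0 horner0 => <-.
  by apply/eqP; congr g; apply/funext=> i; rewrite mul1r addrC subrK.
have /closed_nonrootP[t] : p * q != 0 by rewrite mulf_neq0.
rewrite rootE hornerM -fp -gq => pq.
by exists (fun i => x i + t * (y i - x i)).
Qed.

Definition polymap n (phi : (nat -> CC) -> struct) :=
  forall i j k, polp n (fun x => phi x i j k).

Definition img (phi : (nat -> CC) -> struct) : sset :=
  fun c => exists x, c = phi x.

Lemma polyfun_comp n phi f : polymap n phi -> polyfun f -> polp n (fun x => f (phi x)).
Proof.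
move=> pphi; elim=> [a|i j k|g h _ pg _ ph|g h _ pg _ ph].
- exact: pp_cst.
- exact: pphi.
- exact: (pp_add pg ph).
- exact: (pp_mul pg ph).
Qed.

(** If a polynomial vanished on [S] but not on the whole image, its pullback times [D] would vanish
    everywhere although neither factor does. *)
Lemma image_dense n phi D (S : sset) y : polymap n phi -> polp n D -> D y != 0 ->
  (forall x, D x != 0 -> S (phi x)) -> subs (img phi) (zclosure S).
Proof.
move=> pphi pD Dy DS _ [x ->] T cT ST; apply: contrapT => Tx.
have [f [pf f0 fx]] := zclosed_nonzero cT Tx.
have [z] := polp_domain (polyfun_comp pphi pf) pD fx Dy.
have [->|/DS/ST/f0->] := eqVneq (D z) 0; first by rewrite mulr0 eqxx.
by rewrite mul0r eqxx.
Qed.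

(** Polynomials vanishing on [A] and on [B], each nonzero somewhere on the image, would have a
    product vanishing on the image, against [polp_domain]. *)
Lemma irreducible_image n phi : polymap n phi ->
  irreducible_closed (zclosure (img phi)).
Proof.
move=> pphi; split; first exact: zclosure_closed.
  by exists (phi (fun _ => 0)); apply: sub_zclosure; exists (fun _ => 0).
move=> A B cA cB AB; apply: contrapT => /not_orP[nA nB].
have nsub C : zclosed C -> ~ subs (zclosure (img phi)) C ->
    exists f x, polyfun f /\ (forall y, C y -> f y = 0) /\ f (phi x) != 0.
  move=> cC nC; have /existsNP[c /not_implyP[[x ->] Cx]] : ~ subs (img phi) C.
    by move=> sC; apply: nC; apply: zclosure_min.
  by have [f [pf f0 fx]] := zclosed_nonzero cC Cx; exists f, x.
have [f [x [pf [f0 fx]]]] := nsub _ cA nA.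
have [g [y [pg [g0 gy]]]] := nsub _ cB nB.
have [z] := polp_domain (polyfun_comp pphi pf) (polyfun_comp pphi pg) fx gy.
have : zclosure (img phi) (phi z) by apply: sub_zclosure; exists z.
by move=> /AB[/f0|/g0] ->; rewrite ?mul0r ?mulr0 eqxx.
Qed.

(** * Bounding the length of chains of irreducible closed sets *)

Definition expo n D := {ffun 'I_n -> 'I_D.+1}.

(** Degrees are bounded in each variable separately, so the spanning monomials number [D.+1 ^ n] and
    bounds simply add under products. *)
Definition box n D (f : (nat -> CC) -> CC) :=
  exists a : expo n D -> CC,
    forall x, f x = \sum_e a e * \prod_(i < n) x i ^+ e i.

Lemma box_add n D f g : box n D f -> box n D g -> box n D (fun x => f x + g x).
Proof.
move=> [a fa] [b gb]; exists (fun e => a e + b e) => x.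
by rewrite fa gb -big_split; apply: eq_bigr => e _; rewrite mulrDl.
Qed.

Lemma box_scale n D c f : box n D f -> box n D (fun x => c * f x).
Proof.
move=> [a fa]; exists (fun e => c * a e) => x.
by rewrite fa mulr_sumr; apply: eq_bigr => e _; rewrite mulrA.
Qed.

Lemma box_sum n D (I : Type) (r : seq I) (F : I -> (nat -> CC) -> CC) :
  (forall i, box n D (F i)) -> box n D (fun x => \sum_(i <- r) F i x).
Proof.
move=> bF; elim: r => [|i r [a IH]].
  by exists (fun _ => 0) => x; rewrite big_nil big1 // => e _; rewrite mul0r.
have [b Fb] := bF i; exists (fun e => b e + a e) => x.
rewrite big_cons Fb IH -big_split; apply: eq_bigr => e _; by rewrite mulrDl.
Qed.

Lemma box_mon n D (u : 'I_n -> nat) : (forall i, (u i <= D)%N) ->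
  box n D (fun x => \prod_(i < n) x i ^+ u i).
Proof.
move=> uD; exists (fun e => (e == [ffun i => inord (u i)])%:R) => x.
rewrite (bigD1 [ffun i => inord (u i)]) //= eqxx mul1r.
rewrite [X in _ + X]big1 ?addr0 => [|e ne]; last by rewrite (negbTE ne) mul0r.
by apply: eq_bigr => i _; rewrite ffunE inordK // ltnS.
Qed.

Lemma box_mul n D E f g : box n D f -> box n E g -> box n (D + E) (fun x => f x * g x).
Proof.
move=> [a fa] [b gb].
rewrite (_ : (fun _ => _) = fun x : nat -> CC => \sum_(e : expo n D) \sum_(e' : expo n E)
   (a e * b e') * \prod_(i < n) x i ^+ (e i + e' i)); last first.
  apply/funext => x; rewrite fa gb mulr_suml; apply: eq_bigr => e _.
  rewrite mulr_sumr; apply: eq_bigr => e' _; rewrite mulrACA -big_split /=.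
  by congr (_ * _); apply: eq_bigr => i _; rewrite exprD.
apply: box_sum => e; apply: box_sum => e'; apply/box_scale/box_mon => i.
by apply: leq_add; rewrite -ltnS.
Qed.

Lemma box_mono n D E f : (D <= E)%N -> box n D f -> box n E f.
Proof.
move=> DE [a fa]; rewrite (_ : f = fun x : nat -> CC => \sum_e a e * \prod_(i < n) x i ^+ e i).
  apply: box_sum => e; apply/box_scale/box_mon => i.
  by apply: leq_trans DE; rewrite -ltnS.
exact/funext.
Qed.

Lemma box_cst n D c : box n D (fun _ => c).
Proof.
rewrite (_ : (fun _ => c) = fun x : nat -> CC => c * \prod_(i < n) x i ^+ 0).
  exact/box_scale/box_mon.
by apply/funext => x; rewrite big1 ?mulr1.
Qed.

Lemma box_exp n D f k : box n D f -> box n (D * k) (fun x => f x ^+ k).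
Proof.
move=> bf; elim: k => [|k IH]; first exact: box_cst.
rewrite mulnS (_ : (fun _ => _) = fun x => f x * f x ^+ k); first exact: box_mul.
by apply/funext => x; rewrite exprS.
Qed.

Lemma polp_box n f : polp n f -> exists D, box n D f.
Proof.
elim=> [a|i ltin|g h _ [D bg] _ [E bh]|g h _ [D bg] _ [E bh]].
- by exists 0; apply: box_cst.
- exists 1; rewrite (_ : (fun _ => _) = fun x : nat -> CC => \prod_(j < n) x j ^+ (i == j)).
    by apply: box_mon => j; apply: leq_b1.
  apply/funext => x; rewrite (bigD1 (Ordinal ltin)) //= eqxx big1 ?mulr1 // => j.
  rewrite -val_eqE /= eq_sym => /negbTE ->; exact: expr0.
- exists (D + E)%N; apply: box_add; [apply: box_mono bg|apply: box_mono bh]; lia.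
- by exists (D + E)%N; apply: box_mul.
Qed.

Definition independent (Z : sset) (I : finType) (F : I -> struct -> CC) :=
  forall a : I -> CC, (forall x, Z x -> \sum_i a i * F i x = 0) -> forall i, a i = 0.

(** With more functions than monomials, the coefficient matrix of the pullbacks has a nonzero left
    kernel vector. The corresponding combination vanishes on the image, hence on its closure and on
    [Z]. *)
Lemma independent_box n phi (Z : sset) (I : finType) (F : I -> struct -> CC) D :
  polymap n phi -> subs Z (zclosure (img phi)) ->
  (forall i, polyfun (F i)) -> (forall i, box n D (fun x => F i (phi x))) ->
  independent Z F -> (#|I| <= D.+1 ^ n)%N.
Proof.
move=> pphi Zphi pF bF indF; rewrite leqNgt; apply/negP => ltI.
have [A FA] := boolp.choice bF.
pose M := \matrix_(i < #|I|, j < #|expo n D|) A (enum_val i) (enum_val j).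
have : kermx M != 0.
  rewrite kermx_eq0 /row_free; apply/negP => /eqP rM.
  have := rank_leq_col M; rewrite rM leqNgt => /negP; apply.
  by apply: leq_trans ltI; rewrite card_ffun !card_ord.
move=> /rowV0Pn[v /sub_kermxP vM v0].
suff v00 : forall i, v 0 (enum_rank i) = 0.
  case/eqP: v0; apply/rowP => i; rewrite mxE.
  by rewrite -[i]enum_valK v00.
apply: indF => c Zc; pose f c := \sum_i v 0 (enum_rank i) * F i c.
apply: (zclosure_zero (f := f) _ _ (Zphi _ Zc)).
  by apply: polyfun_sum => i; apply: pf_mul => //; apply: pf_cst.
move=> _ [x ->]; rewrite /f.
under eq_bigr do rewrite FA mulr_sumr.
rewrite exchange_big big1 // => e _.
under eq_bigr do rewrite mulrA.
rewrite -mulr_suml; apply/eqP; rewrite mulf_eq0; apply/orP; left; apply/eqP.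
transitivity ((v *m M) 0 (enum_rank e)); last by rewrite vM mxE.
rewrite mxE (reindex (@enum_rank I)) /=; last first.
  by exists enum_val => i _; rewrite ?enum_rankK ?enum_valK.
by apply: eq_bigr => i _; rewrite mxE !enum_rankK.
Qed.

(** Restricting a relation among the [f ^+ k * F i] to [Y] kills all terms with [k > 0], so the
    coefficients for [k = 0] vanish. The remaining sum is divisible by [f], which cancels because
    [Z] is irreducible and [f] is not zero on it. *)
Lemma independent_step (Y Z : sset) (I : finType) (F : I -> struct -> CC) f N :
  irreducible_closed Z -> subs Y Z -> polyfun f -> (forall i, polyfun (F i)) ->
  (forall x, Y x -> f x = 0) -> ~ (forall x, Z x -> f x = 0) -> independent Y F ->
  independent Z (fun ik : I * 'I_N => fun x => f x ^+ ik.2 * F ik.1 x).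
Proof.
move=> irrZ YZ pf pF fY fZ indF a a0.
(* Coefficients are indexed by [nat] so that the induction on [M] can shift them after [f] is
   cancelled. *)
suff H (b : nat -> I -> CC) M :
    (forall x, Z x -> \sum_(k < M) f x ^+ k * \sum_i b k i * F i x = 0) ->
    forall k i, (k < M)%N -> b k i = 0.
  case=> i k.
  pose b m j := if insub m is Some m' then a (j, m') else 0.
  have bE (k' : 'I_N) j : b k' j = a (j, k') by rewrite /b valK.
  rewrite -bE; apply: (H b N) => // x Zx; rewrite -[RHS](a0 x Zx).
  rewrite (eq_bigr (fun k : 'I_N => \sum_i a (i, k) * (f x ^+ k * F i x))).
    by rewrite exchange_big pair_bigA; apply: eq_bigr => -[].
  by move=> k' _; rewrite mulr_sumr; apply: eq_bigr => j _; rewrite bE mulrCA.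
elim: M b => // M IH b Hb.
have b0 i : b 0%N i = 0.
  apply: (indF (b 0%N)) => x Yx; rewrite -[RHS](Hb x (YZ _ Yx)) big_ord_recl /= expr0 mul1r.
  by rewrite [X in _ + X]big1 ?addr0 // => k _; rewrite fY // exprS !mul0r.
have := irreducible_mul (f := f)
  (g := fun x => \sum_(k < M) f x ^+ k * \sum_i b k.+1 i * F i x) irrZ pf.
case=> //.
- apply: polyfun_sum => k; apply: pf_mul; first exact: polyfunX.
  by apply: polyfun_sum => i; apply: pf_mul => //; apply: pf_cst.
- move=> x Zx; rewrite -[RHS](Hb x Zx) big_ord_recl /= expr0 mul1r.
  rewrite [X in _ = X + _]big1 ?add0r; last by move=> i _; rewrite b0 mul0r.
  by rewrite mulr_sumr; apply: eq_bigr => k _; rewrite exprS mulrA.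
- move=> H [|k] i // ltkM; exact: (IH (fun k => b k.+1)).
Qed.

(* The functions are the monomials [f_1 ^ k_1 ... f_m ^ k_m] with [k_j < N],
   where [f_j] vanishes on [Zs (j - 1)] but not on [Zs j]. *)
Lemma chain_independent n phi m Zs S : polymap n phi -> irr_chain S m Zs ->
  exists d, forall N, exists (I : finType) (F : I -> struct -> CC),
    [/\ #|I| = (N ^ m)%N, forall i, polyfun (F i),
        forall i, box n (d * N) (fun x => F i (phi x)) & independent (Zs m) F].
Proof.
move=> pphi; elim: m => [|m IH] [irr inc].
  exists 0%N => N; exists unit, (fun _ _ => 1); split.
  - by rewrite card_unit.
  - by move=> _; apply: pf_cst.
  - by move=> _; apply: box_cst.
  have [[_ [x Zx] _] _] := irr 0 (leqnn _).
  move=> a /(_ x Zx); rewrite (bigD1 tt) //= mulr1.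
  by rewrite [X in _ + X]big1 ?addr0 => [a0 []|[]].
have [d Hd] : exists d, forall N, exists (I : finType) (F : I -> struct -> CC),
    [/\ #|I| = (N ^ m)%N, forall i, polyfun (F i),
        forall i, box n (d * N) (fun x => F i (phi x)) & independent (Zs m) F].
  apply: IH; split=> i im; [apply: irr|apply: inc]; lia.
have [sub nsub] := inc m (ltnSn _).
have [irrm _] := irr m (leqnSn _); have [irrm1 _] := irr m.+1 (leqnn _).
have /existsNP[x /not_implyP[Zx nZx]] := nsub.
have [f [pf f0 fx]] := zclosed_nonzero (let: And3 h _ _ := irrm in h) nZx.
have [e be] := polp_box (polyfun_comp pphi pf).
exists (d + e)%N => N; have [I [F [cI pF bF indF]]] := Hd N.
exists (I * 'I_N)%type, (fun (ik : I * 'I_N) x => f x ^+ ik.2 * F ik.1 x); split.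
- by rewrite card_prod cI card_ord expnS mulnC.
- by move=> [i k]; apply: pf_mul => //; apply: polyfunX.
(* As [k < N], the power of [f] adds at most [e * N] to the degree, whence the new constant
   [d + e]. *)
- move=> [i k]; apply: (@box_mono _ (e * k + d * N)).
    by have := ltn_ord k; rewrite /=; nia.
  by apply: box_mul => //; apply: box_exp.
- by apply: independent_step indF => // f0'; move: fx; rewrite f0' ?eqxx.
Qed.

Lemma no_long_chain n phi S : polymap n phi -> subs S (zclosure (img phi)) ->
  ~ exists Zs, irr_chain S n.+1 Zs.
Proof.
move=> pphi Sphi [Zs ch]; have [d Hd] := chain_independent pphi ch.
(* The counts give [N ^ n.+1 <= (d * N).+1 ^ n <= d.+1 ^ n * N ^ n], which fails once [N] exceeds
   [d.+1 ^ n]. *)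
pose N := (d.+1 ^ n).+1; have [I [F [cI pF bF indF]]] := Hd N.
have [_ ZS] := ch.1 n.+1 (leqnn _).
have := independent_box pphi (fun x Zx => Sphi x (ZS x Zx)) pF bF indF.
rewrite cI leqNgt => /negP; apply.
apply: (@leq_ltn_trans ((d.+1 * N) ^ n)).
  by case: (n) => // n'; rewrite leq_exp2r // mulSn /N; lia.
by rewrite expnMn expnS ltn_pmul2r ?expn_gt0.
Qed.

Lemma krull_dim_le S n : irreducible_closed S -> ~ (exists Zs, irr_chain S n.+1 Zs) ->
  exists m, (m <= n)%N /\ krull_dim S m.
Proof.
move=> irrS; elim: n => [|n IH] no.
  by exists 0%N; do 2?split=> //; exists (fun _ => S); split=> // i _; split.
have [yes|/IH[m [lemn Sm]]] := pselect (exists Zs, irr_chain S n.+1 Zs).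
  by exists n.+1.
by exists m; split=> //; apply: leqW.
Qed.

(** * Orbits *)

Definition i0 : 'I_3 := @Ordinal 3 0 isT.
Definition i1 : 'I_3 := @Ordinal 3 1 isT.
Definition i2 : 'I_3 := @Ordinal 3 2 isT.

Lemma ord3_ind (P : 'I_3 -> Prop) : P i0 -> P i1 -> P i2 -> forall i, P i.
Proof.
move=> P0 P1 P2 [[|[|[|i]]] Hi] //.
- by rewrite (_ : Ordinal _ = i0) //; apply: val_inj.
- by rewrite (_ : Ordinal _ = i1) //; apply: val_inj.
- by rewrite (_ : Ordinal _ = i2) //; apply: val_inj.
Qed.

Lemma sum3 (F : 'I_3 -> CC) : \sum_i F i = F i0 + F i1 + F i2.
Proof.
rewrite !big_ord_recr big_ord0 /= add0r.
by congr (F _ + F _ + F _); apply: val_inj.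
Qed.

Definition hom (h : 'M[CC]_3) (d c : struct) :=
  forall x y, mapv h (mul d x y) = mul c (mapv h x) (mapv h y).

Lemma hom_basis (h : 'M[CC]_3) (d c : struct) :
  (forall i j l, \sum_k h l k * d i j k = \sum_m \sum_n h m i * h n j * c m n l) ->
  hom h d c.
Proof.
move=> H x y; apply/funext => l; rewrite /mapv /mul.
transitivity (\sum_i \sum_j x i * y j * \sum_k h l k * d i j k).
  by rewrite !sum3; ring.
under eq_bigr do under eq_bigr do rewrite H.
by rewrite !sum3; ring.
Qed.

Lemma mul_basis c i j : mul c (basis i) (basis j) = c i j.
Proof.
apply/funext => k; rewrite /mul (bigD1 i) //= (bigD1 j) //= /basis !eqxx !mul1r.
rewrite !big1 ?addr0 // => [i' /negbTE ne|j' /negbTE ne].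
  by rewrite big1 // => j' _; rewrite ne !mul0r.
by rewrite ne mulr0 mul0r.
Qed.

Lemma mapv_mul g h x : mapv g (mapv h x) = mapv (g *m h) x.
Proof.
apply/funext => k; rewrite /mapv.
under eq_bigr do rewrite mulr_sumr.
rewrite exchange_big; apply: eq_bigr => l _ /=.
by rewrite mxE mulr_suml; apply: eq_bigr => m _; rewrite mulrA.
Qed.

Lemma mapv1 x : mapv 1%:M x = x.
Proof.
apply/funext => k; rewrite /mapv (bigD1 k) //= mxE eqxx mul1r big1 ?addr0 // => l.
by rewrite mxE eq_sym => /negbTE ->; rewrite mul0r.
Qed.

Lemma mapvK h : h \in unitmx -> cancel (mapv h) (mapv (invmx h)).
Proof. by move=> uh x; rewrite mapv_mul mulVmx // mapv1. Qed.

Lemma mapv_basis h i : mapv h (basis i) = fun k => h k i.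
Proof.
apply/funext => k; rewrite /mapv /basis (bigD1 i) //= eqxx mulr1 big1 ?addr0 // => l.
by move=> /negbTE ->; rewrite mulr0.
Qed.

Lemma hom_inj h d d' c : h \in unitmx -> hom h d c -> hom h d' c -> d = d'.
Proof.
move=> uh H H'; apply/funext => i; apply/funext => j.
by rewrite -!mul_basis -[LHS](mapvK uh) H -H' mapvK.
Qed.

Lemma hom_act g c : g \in unitmx -> hom (invmx g) (act g c) c.
Proof.
move=> ug; apply: hom_basis => i j l.
transitivity (mapv (invmx g) (act g c i j) l); first by [].
by rewrite /act mapvK // !mapv_basis.
Qed.

Lemma hom_comp h h' b c d : hom h d c -> hom h' c b -> hom (h' *m h) d b.
Proof. by move=> H H' x y; rewrite -!mapv_mul H H'. Qed.

Lemma hom_inv h d c : h \in unitmx -> hom h d c -> hom (invmx h) c d.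
Proof.
move=> uh H x y.
have K z : mapv h (mapv (invmx h) z) = z by rewrite mapv_mul mulmxV // mapv1.
by rewrite -[RHS](mapvK uh) H !K.
Qed.

Lemma grp_inv g : grp g -> grp (invmx g).
Proof.
case=> ug bg; split; first by rewrite unitmx_inv.
have E1 := mulVmx ug; have E2 := mulmxV ug.
have E i j : \sum_k invmx g i k * g k j = (i == j)%:R.
  by move: (congr1 (fun M : 'M_3 => M i j) E1); rewrite !mxE.
have E' i j : \sum_k g i k * invmx g k j = (i == j)%:R.
  by move: (congr1 (fun M : 'M_3 => M i j) E2); rewrite !mxE.
have z02 : g i0 i2 = 0 by apply: bg.
have z12 : g i1 i2 = 0 by apply: bg.
have z20 : g i2 i0 = 0 by apply: bg.
have z21 : g i2 i1 = 0 by apply: bg.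
have nz : g i2 i2 != 0.
  move: (E i2 i2); rewrite sum3 z02 z12 !mulr0 !add0r => e.
  by apply/eqP => e0; move/eqP: e; rewrite e0 mulr0 eq_sym oner_eq0.
have R i : i != i2 -> invmx g i i2 = 0.
  move=> ne; move: (E i i2); rewrite sum3 z02 z12 (negbTE ne) !mulr0 !add0r.
  by move/eqP; rewrite mulf_eq0 (negbTE nz) orbF => /eqP.
have C j : j != i2 -> invmx g i2 j = 0.
  move=> ne; move: (E' i2 j); rewrite sum3 z20 z21 eq_sym (negbTE ne) !mul0r !add0r.
  by move/eqP; rewrite mulf_eq0 (negbTE nz) => /eqP.
by do 2![apply: ord3_ind] => //= _; rewrite ?R ?C.
Qed.

Lemma grp_mul g h : grp g -> grp h -> grp (g *m h).
Proof.
move=> [ug bg] [uh bh]; split; first by rewrite unitmx_mul ug.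
move=> i j ij; rewrite mxE big1 // => k _.
have [ik|/bg->] := eqVneq (par i) (par k); last by rewrite mul0r.
by rewrite bh ?mulr0 // -ik.
Qed.

(** Here [h] is the inverse of the acting group element. Isomorphisms onto [c] replace the inverse
    matrices of [act] by equations polynomial in the entries of [h]. *)
Lemma gorbitP c d : gorbit c d <-> exists2 h, grp h & hom h d c.
Proof.
split=> [[g [gg ->]]|[h gh H]].
  by exists (invmx g); [apply: grp_inv|case: gg => ug _; apply: hom_act].
exists (invmx h); have gi := grp_inv gh; split=> //.
case: gh gi => uh _ [ui _].
by apply: (hom_inj uh H); have := hom_act c ui; rewrite invmxK.
Qed.

Lemma gorbit_refl c : gorbit c c.
Proof.
apply/gorbitP; exists 1%:M; last by move=> x y; rewrite !mapv1.
split=> [|i j]; first exact: unitmx1.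
by rewrite mxE; have [->|//] := eqVneq i j; rewrite eqxx.
Qed.

Lemma gorbit_sym c d : gorbit c d -> gorbit d c.
Proof.
case/gorbitP => h gh H; apply/gorbitP; exists (invmx h); first exact: grp_inv.
by case: gh => uh _; apply: hom_inv.
Qed.

Lemma gorbit_trans b c d : gorbit b c -> gorbit c d -> gorbit b d.
Proof.
case/gorbitP => h gh H /gorbitP[h' gh' H']; apply/gorbitP.
by exists (h *m h'); [apply: grp_mul|apply: hom_comp H].
Qed.

Lemma gorbit_eq c d : gorbit c d -> gorbit c = gorbit d.
Proof.
move=> cd; apply/sset_eq => x; split; last exact: gorbit_trans.
by apply: gorbit_trans; apply: gorbit_sym.
Qed.

(** * The variety of binary perm structures *)

Lemma mapvD h x y : mapv h (vadd x y) = vadd (mapv h x) (mapv h y).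
Proof.
apply/funext => k; rewrite /mapv /vadd -big_split; apply: eq_bigr => l _.
by rewrite mulrDr.
Qed.

Lemma mapvZ h a x : mapv h (vscale a x) = vscale a (mapv h x).
Proof.
apply/funext => k; rewrite /mapv /vscale mulr_sumr; apply: eq_bigr => l _.
by rewrite mulrCA.
Qed.

Lemma homog_mapv h a x : grp h -> homog a x -> homog a (mapv h x).
Proof.
move=> [_ bh] hx i ia; rewrite /mapv big1 // => j _.
have [ja|ja] := eqVneq (par j) a; last by rewrite hx ?mulr0.
by rewrite bh ?mul0r // ja.
Qed.

Lemma perm_identities_hom h d c : grp h -> hom h d c ->
  perm_identities c -> perm_identities d.
Proof.
move=> gh H pc a b e x y z hx hy hz; have [uh _] := gh.
have A u v w : mapv h (assoc d u v w) = assoc c (mapv h u) (mapv h v) (mapv h w).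
  by rewrite /assoc mapvD mapvZ !H.
have [I1 I2 I3] := pc a b e _ _ _ (homog_mapv gh hx) (homog_mapv gh hy) (homog_mapv gh hz).
by split; apply: (can_inj (mapvK uh)); rewrite ?mapvD !mapvZ ?A ?H.
Qed.

Lemma polyfunN f : polyfun f -> polyfun (fun c => - f c).
Proof.
move=> pf; rewrite (_ : (fun _ => _) = fun c => (-1) * f c).
  by apply: pf_mul => //; apply: pf_cst.
by apply/funext => x; rewrite mulN1r.
Qed.

Lemma polyfun_mul (u v : struct -> vec) k :
  (forall i, polyfun (fun c => u c i)) -> (forall i, polyfun (fun c => v c i)) ->
  polyfun (fun c => mul c (u c) (v c) k).
Proof.
move=> pu pv; apply: polyfun_sum => i; apply: polyfun_sum => j.
by apply: pf_mul; [apply: pf_mul|apply: pf_coord].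
Qed.

(** At fixed vectors and in a fixed coordinate, each identity equates two polynomial functions of
    [c]. The defining family is taken to be all polynomials vanishing on the variety. *)
Lemma PermVar_closed : zclosed PermVar.
Proof.
exists (fun f => polyfun f /\ forall c, PermVar c -> f c = 0); split=> [f []//|c].
split=> [Pc f [_]|H]; first exact.
have vanish f g : polyfun f -> polyfun g -> (forall c', PermVar c' -> f c' = g c') -> f c = g c.
  move=> pf pg fg; apply/eqP; rewrite -subr_eq0; apply/eqP.
  apply: (H (fun c => f c - g c)); split=> [|c' /fg ->]; last by rewrite subrr.
  by apply: pf_add => //; apply: polyfunN.
have pb (x : vec) i : polyfun (fun _ : struct => x i) by apply: pf_cst.
have ps a (u : struct -> vec) i :
  polyfun (fun c => u c i) -> polyfun (fun c => vscale a (u c) i).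
  by move=> pu; apply: pf_mul => //; apply: pf_cst.
have pa x y z i : polyfun (fun c => assoc c x y z i).
  apply: pf_add; first by apply: polyfun_mul => // j; apply: polyfun_mul.
  by apply: (ps _ (fun c => mul c x (mul c y z))); apply: polyfun_mul => // j; apply: polyfun_mul.
split=> [i j k ijk|a b e x y z hx hy hz].
  by apply: (vanish (fun c => c i j k) (fun=> 0)); [apply: pf_coord|apply: pf_cst|move=> c' [ec _]; apply: ec].
split; apply/funext => k.
- apply: (vanish (fun c => assoc c x y z k) (fun c => vscale _ (assoc c x z y) k)) => //.
    by apply: (ps _ (fun c => assoc c x z y)).
  by move=> c' [_ /(_ _ _ _ _ _ _ hx hy hz)[->]].
- apply: (vanish (fun c => assoc c x y z k) (fun c => vscale _ (assoc c y x z) k)) => //.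
    by apply: (ps _ (fun c => assoc c y x z)).
  by move=> c' [_ /(_ _ _ _ _ _ _ hx hy hz)[_ ->]].
- apply: (vanish (fun c => vadd (mul c (mul c x y) z) (vscale _ (mul c (mul c z y) x)) k)
     (fun c => vadd (vscale _ (mul c (mul c x z) y)) (vscale _ (mul c (mul c z x) y)) k)).
  + apply: pf_add; first by apply: polyfun_mul => // j; apply: polyfun_mul.
    by apply: (ps _ (fun c => mul c (mul c z y) x)); apply: polyfun_mul => // j; apply: polyfun_mul.
  + apply: pf_add; [apply: (ps _ (fun c => mul c (mul c x z) y))
                   |apply: (ps _ (fun c => mul c (mul c z x) y))];
      by apply: polyfun_mul => // j; apply: polyfun_mul.
  + by move=> c' [_ /(_ _ _ _ _ _ _ hx hy hz)[_ _ ->]].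
Qed.

(** * Coordinates and parametrizations of the orbits *)

(* The products are e1e1 = A, e1e2 = B, e2e1 = C, e2e2 = D, e_i f1 = l_i f1,
   f1 e_i = r_i f1 and f1 f1 = s. *)
Definition mk (A1 A2 B1 B2 C1 C2 D1 D2 l1 l2 r1 r2 s1 s2 : CC) : struct :=
  fun i j k => nth 0 [:: A1; A2; 0; B1; B2; 0; 0; 0; l1;
                         C1; C2; 0; D1; D2; 0; 0; 0; l2;
                         0; 0; r1; 0; 0; r2; s1; s2; 0] (9 * i + 3 * j + k).

Lemma struct_ext (c d : struct) : (forall i j k, c i j k = d i j k) -> c = d.
Proof. by move=> cd; do 3![apply/funext => ?]. Qed.

Lemma mk_even A1 A2 B1 B2 C1 C2 D1 D2 l1 l2 r1 r2 s1 s2 :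
  even_struct (mk A1 A2 B1 B2 C1 C2 D1 D2 l1 l2 r1 r2 s1 s2).
Proof. by do 3![apply: ord3_ind]. Qed.

Lemma even_mk c : even_struct c ->
  c = mk (c i0 i0 i0) (c i0 i0 i1) (c i0 i1 i0) (c i0 i1 i1)
         (c i1 i0 i0) (c i1 i0 i1) (c i1 i1 i0) (c i1 i1 i1)
         (c i0 i2 i2) (c i1 i2 i2) (c i2 i0 i2) (c i2 i1 i2)
         (c i2 i2 i0) (c i2 i2 i1).
Proof.
by move=> ec; apply: struct_ext; do 3![apply: ord3_ind] => //; rewrite ec.
Qed.

Lemma polymap_mk n A1 A2 B1 B2 C1 C2 D1 D2 l1 l2 r1 r2 s1 s2 :
  polp n A1 -> polp n A2 -> polp n B1 -> polp n B2 -> polp n C1 -> polp n C2 ->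
  polp n D1 -> polp n D2 -> polp n l1 -> polp n l2 -> polp n r1 -> polp n r2 ->
  polp n s1 -> polp n s2 ->
  polymap n (fun x => mk (A1 x) (A2 x) (B1 x) (B2 x) (C1 x) (C2 x) (D1 x) (D2 x)
                         (l1 x) (l2 x) (r1 x) (r2 x) (s1 x) (s2 x)).
Proof. by move=> *; do 3![apply: ord3_ind] => //; apply: pp_cst. Qed.

Ltac polp_tac :=
  repeat first [ by apply: pp_var | apply: pp_cst | apply: pp_opp
               | apply: pp_add | apply: pp_mul ].

(* The rows of [hm p q r s t] are the coordinate functionals on the graded space. *)
Definition hm (p q r s t : CC) : 'M[CC]_3 :=
  \matrix_(i, j) nth 0 [:: p; q; 0; r; s; 0; 0; 0; t] (3 * i + j).

Lemma mx3_ext (M N : 'M[CC]_3) : (forall i j, M i j = N i j) -> M = N.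
Proof. by move=> MN; apply/matrixP. Qed.

Lemma grp_hm p q r s t : (p * s - q * r) * t != 0 -> grp (hm p q r s t).
Proof.
rewrite mulf_eq0 negb_or => /andP[D0 t0]; split; last first.
  by do 2![apply: ord3_ind] => //; rewrite mxE.
pose D := p * s - q * r.
apply: (proj1 (@mulmx1_unit _ _ _ (hm (s / D) (- q / D) (- r / D) (p / D) t^-1) _)).
apply: mx3_ext; do 2![apply: ord3_ind]; rewrite !mxE sum3 !mxE /= /D; field;
  by rewrite ?D0 ?t0.
Qed.

Lemma det2_neq0 (p q r s p' q' r' s' : CC) :
  p * p' + q * r' = 1 -> p * q' + q * s' = 0 -> r * q' + s * s' = 1 ->
  p * s - q * r != 0.
Proof.
move=> e1 e2 e4; apply: contra_eq_neq e1 => z.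
have : (p * p' + q * r') * (r * q' + s * s')
     = (p * s - q * r) * (p' * s' - q' * r') + (p * q' + q * s') * (r * p' + s * r').
  by ring.
by rewrite e4 z e2 mulr1 !mul0r addr0 => ->; rewrite eq_sym oner_eq0.
Qed.

Lemma grp_hmP h : grp h -> exists p q r s t, (p * s - q * r) * t != 0 /\ h = hm p q r s t.
Proof.
move=> gh; have [uh bh] := gh; have [_ bg] := grp_inv gh.
exists (h i0 i0), (h i0 i1), (h i1 i0), (h i1 i1), (h i2 i2); split; last first.
  by apply: mx3_ext; do 2![apply: ord3_ind]; rewrite !mxE //= bh.
have E i j : \sum_k h i k * invmx h k j = (i == j)%:R.
  by move: (congr1 (fun M : 'M_3 => M i j) (mulmxV uh)); rewrite !mxE.
move: (E i0 i0) (E i0 i1) (E i1 i0) (E i1 i1) (E i2 i2); rewrite !sum3.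
rewrite (bg i2 i0) // (bg i2 i1) // (bh i2 i0) // (bh i2 i1) //.
rewrite !mulr0 !mul0r !addr0 !add0r => e1 e2 _ e4 e5.
rewrite mulf_neq0 ?(det2_neq0 e1 e2 e4) //.
by apply/eqP => t0; move/eqP: e5; rewrite t0 mul0r eq_sym oner_eq0.
Qed.

Lemma gorbit_hm c d : gorbit c d <->
  exists p q r s t, (p * s - q * r) * t != 0 /\ hom (hm p q r s t) d c.
Proof.
rewrite gorbitP; split=> [[h /grp_hmP[p [q [r [s [t [nz ->]]]]]] H]|].
  by exists p, q, r, s, t.
by case=> p [q [r [s [t [nz H]]]]]; exists (hm p q r s t) => //; apply: grp_hm.
Qed.

Ltac hom_tac :=
  apply: hom_basis; do 3![apply: ord3_ind]; rewrite !sum3 /hm !mxE /mk /=.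

(** The seven algebras fall into three shapes: even part C x C ([RS]), even product x y = l(y) x
    ([RU]), and nonzero odd square ([RQ]). In the first two, e1 acts on f1 by [u] from the left and
    [v] from the right. *)
Definition RS u v := mk 1 0 0 0 0 0 0 1 u 0 v 0 0 0.
Definition RU u v := mk 1 0 0 0 0 1 0 0 u 0 v 0 0 0.
Definition RQ := mk 1 0 0 0 0 0 0 0 0 0 0 0 0 1.

Lemma RlistE : [/\ Rlist (@Ordinal 7 0 isT) = RS 0 0, Rlist (@Ordinal 7 1 isT) = RS 1 1,
  Rlist (@Ordinal 7 2 isT) = RS 0 1, Rlist (@Ordinal 7 3 isT) = RQ &
  [/\ Rlist (@Ordinal 7 4 isT) = RU 0 0, Rlist (@Ordinal 7 5 isT) = RU 0 1 &
  Rlist (@Ordinal 7 6 isT) = RU 1 1]].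
Proof.
by split; first [split|idtac]; apply: struct_ext; do 3![apply: ord3_ind].
Qed.

(* [det (l1, l2) * (l1 l1 e1 + l2 l2 e2)], where [l1 = (p, q)], [l2 = (r, s)]
   and [(e1, e2)] is the dual basis; the odd part is acted upon through [det * l1]. *)
Definition semisimple (u v p q r s : CC) : struct :=
  let D := p * s - q * r in
  mk (p * p * s - r * r * q) (r * r * p - p * p * r)
     (p * q * s - r * s * q) (r * s * p - p * q * r)
     (p * q * s - r * s * q) (r * s * p - p * q * r)
     (q * q * s - s * s * q) (s * s * p - q * q * r)
     (u * (D * p)) (u * (D * q)) (v * (D * p)) (v * (D * q)) 0 0.

Lemma hom_semisimple u v p q r s t :
  let D := p * s - q * r in
  hom (hm (D * p) (D * q) (D * r) (D * s) t) (semisimple u v p q r s) (RS u v).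
Proof. by rewrite /semisimple /RS; hom_tac; ring. Qed.

Lemma semisimple_orbit u v p q r s : p * s - q * r != 0 ->
  gorbit (RS u v) (semisimple u v p q r s).
Proof.
move=> D0; apply/gorbit_hm; pose D := p * s - q * r.
exists (D * p), (D * q), (D * r), (D * s), 1; split; last exact: hom_semisimple.
by rewrite (_ : _ * 1 = D * D * D) ?mulf_neq0 // /D; ring.
Qed.

Lemma orbit_semisimple u v d : gorbit (RS u v) d ->
  exists p q r s, p * s - q * r != 0 /\ d = semisimple u v p q r s.
Proof.
case/gorbit_hm => p [q [r [s [t [nz H]]]]].
have D0 : p * s - q * r != 0 by apply: contraNneq nz => ->; rewrite mul0r.
(* Scaling the functionals by [z] multiplies [det * l1] by [z ^+ 3], so a cube root of the inverse
   determinant compensates the factor [det] in [semisimple]. *)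
pose z : CC := 3.-root (p * s - q * r)^-1.
have zE : z ^+ 3 * (p * s - q * r) = 1 by rewrite rootCK // mulVf.
exists (z * p), (z * q), (z * r), (z * s); split.
  apply: contra_eq_neq zE => zD0; rewrite (_ : _ * _ = z * (z * p * (z * s) - z * q * (z * r))).
    by rewrite zD0 mulr0 eq_sym oner_eq0.
  by ring.
have [uh _] := grp_hm nz; apply: (hom_inj uh H).
have := hom_semisimple u v (z * p) (z * q) (z * r) (z * s) t => /=.
have E y : (z * p * (z * s) - z * q * (z * r)) * (z * y) = y.
  by rewrite -[RHS]mul1r -zE; ring.
by rewrite !E.
Qed.

(** With l = (p, q) the even product is x y = l(y) x, and f1 is acted on by u l from the left and v
    l from the right. *)
Definition right_unital (u v p q : CC) : struct :=
  mk p 0 q 0 0 p 0 q (u * p) (u * q) (v * p) (v * q) 0 0.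

Lemma hom_right_unital u v p q r s t :
  hom (hm p q r s t) (right_unital u v p q) (RU u v).
Proof. by rewrite /right_unital /RU; hom_tac; ring. Qed.

Lemma right_unital_orbit u v p q : (p, q) != (0, 0) ->
  gorbit (RU u v) (right_unital u v p q).
Proof.
move=> nz; apply/gorbit_hm; have [p0|p0] := eqVneq p 0.
  exists p, q, 1, 0, 1; split; last exact: hom_right_unital.
  by move: nz; rewrite p0 xpair_eqE eqxx /= mulr0 !mulr1 sub0r oppr_eq0.
exists p, q, 0, 1, 1; split; last exact: hom_right_unital.
by rewrite mulr0 !mulr1 subr0.
Qed.

Lemma orbit_right_unital u v d : gorbit (RU u v) d ->
  exists p q, (p, q) != (0, 0) /\ d = right_unital u v p q.
Proof.
case/gorbit_hm => p [q [r [s [t [nz H]]]]]; exists p, q; split.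
  by apply: contraNneq nz => -[-> ->]; rewrite !mul0r subrr mul0r.
have [uh _] := grp_hm nz; apply: (hom_inj uh H); exact: hom_right_unital.
Qed.

(* The even product is [l l w] with [l = (p, q)], and [f1 f1] spans the kernel of [l]. *)
Definition odd_square (p q w1 w2 : CC) : struct :=
  mk (p * p * w1) (p * p * w2) (p * q * w1) (p * q * w2)
     (p * q * w1) (p * q * w2) (q * q * w1) (q * q * w2) 0 0 0 0 (- q) p.

Lemma odd_square_orbit p q w1 w2 : p * w1 + q * w2 != 0 ->
  gorbit RQ (odd_square p q w1 w2).
Proof.
move=> nz; apply/gorbit_hm; pose d := p * w1 + q * w2.
exists (d * p), (d * q), (- d * w2), (d * w1), d; split; last first.
  by rewrite /odd_square /RQ; hom_tac; rewrite /d; ring.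
by rewrite (_ : _ * d = d * d * d * d) ?mulf_neq0 // /d; ring.
Qed.

Lemma orbit_odd_square d : gorbit RQ d ->
  exists p q w1 w2, p * w1 + q * w2 != 0 /\ d = odd_square p q w1 w2.
Proof.
case/gorbit_hm => p [q [r [s [t [nz H]]]]]; have [uh _] := grp_hm nz.
have := nz; rewrite mulf_eq0 negb_or => /andP[D0 t0].
(* The square f1 f1 is t^2 / D times (-q, p), which fixes the scale [x] of the functional. The even
   idempotent is (s, -r) / D, and dividing it by x^2 gives [y] times (s, -r). *)
pose D := p * s - q * r; pose x := t ^+ 2 / D; pose y := D / t ^+ 4.
exists (x * p), (x * q), (y * s), (- y * r); split.
  have x0 : x != 0 by rewrite mulf_neq0 ?expf_neq0 ?invr_eq0.
  have y0 : y != 0 by rewrite mulf_neq0 ?invr_eq0 ?expf_neq0.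
  have -> : x * p * (y * s) + x * q * (- y * r) = x * y * D by rewrite /D; ring.
  by apply: mulf_neq0; [exact: mulf_neq0|exact: D0].
apply: (hom_inj uh H).
by rewrite /odd_square /RQ; hom_tac; rewrite /x /y /D; field; rewrite ?D0 ?t0.
Qed.

Lemma zclosure_orbit n R phi D y : polymap n phi -> polp n D -> D y != 0 ->
  (forall x, D x != 0 -> gorbit R (phi x)) -> subs (gorbit R) (img phi) ->
  zclosure (gorbit R) = zclosure (img phi).
Proof.
move=> pphi pD Dy Dphi sub; apply: sset_eq => c; split; apply: zclosure_sub.
  by move=> d /sub; apply: sub_zclosure.
by apply: (image_dense pphi pD Dy) => x; apply: Dphi.
Qed.

Lemma zclosure_RS u v : zclosure (gorbit (RS u v)) =
  zclosure (img (fun x => semisimple u v (x 0%N) (x 1%N) (x 2%N) (x 3%N))).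
Proof.
apply: (@zclosure_orbit 4 _ _ (fun x => x 0%N * x 3%N - x 1%N * x 2%N)
          (fun i => (i \in [:: 0; 3])%:R)%N).
- by apply: polymap_mk; polp_tac.
- by polp_tac.
- by rewrite /= mulr0 subr0 mulr1 oner_eq0.
- by move=> x; apply: semisimple_orbit.
- move=> d /orbit_semisimple[p [q [r [s [_ ->]]]]].
  by exists (fun i => nth 0 [:: p; q; r; s] i).
Qed.

Lemma zclosure_RU u v : zclosure (gorbit (RU u v)) =
  zclosure (img (fun x => right_unital u v (x 0%N) (x 1%N))).
Proof.
(* Only two coordinates occur, but the source is A^4 so that all seven closures are images of the
   same space. *)
apply: (@zclosure_orbit 4 _ _ (fun x => x 0%N) (fun _ => 1)).
- by apply: polymap_mk; polp_tac.
- by polp_tac.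
- exact: oner_neq0.
- by move=> x x0; apply: right_unital_orbit; apply: contraNneq x0 => -[-> _].
- move=> d /orbit_right_unital[p [q [_ ->]]].
  by exists (fun i => nth 0 [:: p; q] i).
Qed.

Lemma zclosure_RQ : zclosure (gorbit RQ) =
  zclosure (img (fun x => odd_square (x 0%N) (x 1%N) (x 2%N) (x 3%N))).
Proof.
apply: (@zclosure_orbit 4 _ _ (fun x => x 0%N * x 2%N + x 1%N * x 3%N) (fun _ => 1)).
- by apply: polymap_mk; polp_tac.
- by polp_tac.
- by rewrite mulr1 -(natrD _ 1 1) pnatr_eq0.
- by move=> x; apply: odd_square_orbit.
- move=> d /orbit_odd_square[p [q [w1 [w2 [_ ->]]]]].
  by exists (fun i => nth 0 [:: p; q; w1; w2] i).
Qed.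

(** * Classification of binary perm structures *)

Lemma perm_basis (c : struct) i j k l : perm_identities c ->
  let lm i j k := \sum_m c i j m * c m k l in
  let rm i j k := \sum_m c j k m * c i m l in
  let sg i j := sgn (par i) (par j) in
  [/\ lm i j k - rm i j k = - sg j k * (lm i k j - rm i k j),
      lm i j k - rm i j k = - sg i j * (lm j i k - rm j i k) &
      lm i j k + sg i j * sg i k * sg j k * lm k j i
      = sg j k * lm i k j + sg i k * sg j k * lm k i j].
Proof.
move=> pc /=.
have L i' j' k' : mul c (mul c (basis i') (basis j')) (basis k') l
    = \sum_m c i' j' m * c m k' l.
  rewrite mul_basis /mul; apply: eq_bigr => m _.
  rewrite (bigD1 k') //= /basis eqxx mulr1 [X in _ + X]big1 ?addr0 // => n ne.
  by rewrite (negbTE ne) mulr0 mul0r.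
have R i' j' k' : mul c (basis i') (mul c (basis j') (basis k')) l
    = \sum_m c j' k' m * c i' m l.
  rewrite mul_basis /mul (bigD1 i') //= [X in _ + X]big1 ?addr0 => [|m /negbTE ne].
    by apply: eq_bigr => m _; rewrite /basis eqxx mul1r.
  by rewrite big1 // => n _; rewrite /basis ne !mul0r.
have hb i' : homog (par i') (basis i').
  by move=> m; rewrite /basis; case: (eqVneq m i') => [->|//]; rewrite eqxx.
have [I1 I2 I3] := pc _ _ _ _ _ _ (hb i) (hb j) (hb k).
have A i' j' k' : assoc c (basis i') (basis j') (basis k') l
    = \sum_m c i' j' m * c m k' l - \sum_m c j' k' m * c i' m l.
  by rewrite /assoc /vadd /vscale L R mulN1r.
split.
- by move: (congr1 (fun v : vec => v l) I1); rewrite /vscale !A.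
- by move: (congr1 (fun v : vec => v l) I2); rewrite /vscale !A.
- by move: (congr1 (fun v : vec => v l) I3); rewrite /vadd /vscale !L.
Qed.

(** Certificates for polynomial consequences: the known equation is a combination of hypotheses, and
    [ring] or [field] checks that the two differences agree. *)
Lemma eq_by (a b c d : CC) : c = d -> a - b = c - d -> a = b.
Proof. by move=> -> /eqP; rewrite subrr subr_eq0 => /eqP. Qed.

Lemma mulfI0 (a x : CC) : a != 0 -> a * x = 0 -> x = 0.
Proof. by move=> a0 /eqP; rewrite mulf_eq0 (negbTE a0) => /eqP. Qed.

Lemma eqN_eq0 (x : CC) : x = - x -> x = 0.
Proof. by move/eqP; rewrite -addr_eq0 -mulr2n mulrn_eq0 => /eqP. Qed.

(** On even elements the associator changes sign under swaps of neighbours, so it vanishes when two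
    arguments coincide. *)
Lemma even_assoc c i j k l : perm_identities c ->
  [/\ par i = false, par j = false & par k = false] -> [\/ i = j, j = k | i = k] ->
  \sum_m c i j m * c m k l = \sum_m c j k m * c i m l.
Proof.
move=> pc [pi pj pk] e; apply/eqP; rewrite -subr_eq0; apply/eqP.
have [] := perm_basis i j k l pc; rewrite /= /sgn pi pj pk /= !mulN1r => I1 I2 _.
case: e => e; move: I1 I2; rewrite e => I1 I2; [exact: eqN_eq0|exact: eqN_eq0|].
rewrite I2; have [_] := perm_basis j k k l pc.
have [] := perm_basis j k k l pc; rewrite /= /sgn pj pk /= !mulN1r => I _ _ _ _.
by rewrite (eqN_eq0 I) oppr0.
Qed.

Definition right_unital_case c :=
  exists u v p q, [\/ (u, v) = (0, 0), (u, v) = (0, 1) | (u, v) = (1, 1)] /\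
    c = right_unital u v p q.

Definition odd_square_case c := exists p q w1 w2, c = odd_square p q w1 w2.

Definition commutative (u A1 A2 B1 B2 D1 D2 r1 r2 : CC) : struct :=
  mk A1 A2 B1 B2 B1 B2 D1 D2 (u * r1) (u * r2) r1 r2 0 0.

(* Associativity of a commutative product on a plane: the three 2x2 minors of
   the matrix with rows [(A2, B2)], [(B1, D1)], [(B2 - A1, D2 - B1)]. *)
Definition comm_assoc (A1 A2 B1 B2 D1 D2 : CC) : Prop :=
  [/\ A2 * D1 = B1 * B2, A2 * (D2 - B1) = B2 * (B2 - A1) &
      B1 * (D2 - B1) = D1 * (B2 - A1)].

(** Multiplicativity of the functional (r1, r2) on a commutative plane; the zero functional is
    allowed. *)
Definition character (A1 A2 B1 B2 D1 D2 r1 r2 : CC) : Prop :=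
  [/\ A1 * r1 + A2 * r2 = r1 * r1, B1 * r1 + B2 * r2 = r1 * r2 &
      D1 * r1 + D2 * r2 = r2 * r2].

Definition commutative_case c :=
  exists u A1 A2 B1 B2 D1 D2 r1 r2, [/\ u = 0 \/ u = 1,
    comm_assoc A1 A2 B1 B2 D1 D2, character A1 A2 B1 B2 D1 D2 r1 r2 &
    c = commutative u A1 A2 B1 B2 D1 D2 r1 r2].

Ltac perm_simp := rewrite /= ?sum3 /mk /sgn /= ?(mul0r, mulr0, addr0, add0r, mul1r, mulr1, mulN1r, opprK).

Section Cases.
Variables A1 A2 B1 B2 C1 C2 D1 D2 l1 l2 r1 r2 s1 s2 : CC.
Let c := mk A1 A2 B1 B2 C1 C2 D1 D2 l1 l2 r1 r2 s1 s2.
Hypothesis pc : perm_identities c.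


(** Let k = (k1, k2) be the commutator of e1 and e2. The identities show that A2, D1, B2, C1, C2 -
    A1 and D2 - B1 each annihilate k, so all vanish when k is nonzero. *)
Lemma even_part :
  (B1 = C1 /\ B2 = C2) \/
  [/\ A2 = 0, B2 = 0, C1 = 0, D1 = 0 & C2 = A1 /\ D2 = B1].
Proof.
have [/eqP|nk] := eqVneq (B1 - C1, B2 - C2) (0, 0).
  by rewrite xpair_eqE !subr_eq0 => /andP[/eqP-> /eqP->]; left.
right; pose k1 := B1 - C1; pose k2 := B2 - C2.
have k0 x : k1 * x = 0 -> k2 * x = 0 -> x = 0.
  move=> e1 e2; move: nk; rewrite xpair_eqE negb_and => /orP[] k0.
    exact: (mulfI0 k0 e1).
  exact: (mulfI0 k0 e2).
have as_ i j k l (h : [/\ par i = false, par j = false & par k = false])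
  (e : [\/ i = j, j = k | i = k]) := @even_assoc c i j k l pc h e.
have a000 l := @as_ i0 i0 i0 l (And3 erefl erefl erefl) (Or31 _ _ erefl).
have a111 l := @as_ i1 i1 i1 l (And3 erefl erefl erefl) (Or31 _ _ erefl).
have a001 l := @as_ i0 i0 i1 l (And3 erefl erefl erefl) (Or31 _ _ erefl).
have a110 l := @as_ i1 i1 i0 l (And3 erefl erefl erefl) (Or31 _ _ erefl).
have a011 l := @as_ i0 i1 i1 l (And3 erefl erefl erefl) (Or32 _ _ erefl).
have a100 l := @as_ i1 i0 i0 l (And3 erefl erefl erefl) (Or32 _ _ erefl).
have a010 l := @as_ i0 i1 i0 l (And3 erefl erefl erefl) (Or33 _ _ erefl).
have a101 l := @as_ i1 i0 i1 l (And3 erefl erefl erefl) (Or33 _ _ erefl).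
have [_ _ e0] := perm_basis i0 i0 i1 i0 pc; have [_ _ e1] := perm_basis i0 i0 i1 i1 pc.
have [_ _ f0] := perm_basis i1 i1 i0 i0 pc; have [_ _ f1] := perm_basis i1 i1 i0 i1 pc.
move: (a000 i0) (a000 i1) (a111 i0) (a111 i1) (a001 i0) (a001 i1) (a110 i0) (a110 i1)
  (a011 i0) (a011 i1) (a100 i0) (a100 i1) (a010 i0) (a010 i1) (a101 i0) (a101 i1) e0 e1 f0 f1.
rewrite /c; perm_simp.
move=> h1 h2 h3 h4 h5 h6 h7 h8 h9 _ _ h12 h13 _ _ h16 e0 e1 f0 f1.
have zA2 : A2 = 0.
  by apply: k0; rewrite /k1 /k2; [apply: (eq_by (esym h1))|apply: (eq_by (esym h2))]; ring.
have zD1 : D1 = 0.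
  by apply: k0; rewrite /k1 /k2; [apply: (eq_by h3)|apply: (eq_by h4)]; ring.
have zB2 : B2 = 0.
  apply: k0; rewrite /k1 /k2.
    by apply: (eq_by (congr2 (fun x y => x - y) e0 h5)); ring.
  by apply: (eq_by (congr2 (fun x y => x - y) e1 h6)); ring.
have zC1 : C1 = 0.
  apply: k0; rewrite /k1 /k2.
    by apply: (eq_by (congr2 (fun x y => y - x) f0 h7)); ring.
  by apply: (eq_by (congr2 (fun x y => y - x) f1 h8)); ring.
move: k0 h9 h12 h13 h16; rewrite /k1 /k2 zA2 zB2 zC1 zD1 !(mul0r, mulr0, addr0, add0r, sub0r) => k0 h9 h12 h13 h16.
split=> //; split; apply/eqP; rewrite -subr_eq0; apply/eqP/k0.
- by apply: (eq_by (esym h13)); ring.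
- by apply: (eq_by (esym h12)); ring.
- by apply: (eq_by (esym h9)); ring.
- by apply: (eq_by (esym h16)); ring.
Qed.

(** The odd part is a line, so the associator (ei, f1, ej) is zero; hence so are (f1, ei, ej) and
    (ei, ej, f1), which makes r and l multiplicative. The third identity gives l(ei ej) = l_i r_j,
    so l_i (l_j - r_j) = 0 for all i, j. *)
Lemma odd_part1 :
  [/\ A1 * r1 + A2 * r2 = r1 * r1, B1 * r1 + B2 * r2 = r1 * r2,
      C1 * r1 + C2 * r2 = r1 * r2 & D1 * r1 + D2 * r2 = r2 * r2] /\
  (l1 = 0 /\ l2 = 0 \/ l1 = r1 /\ l2 = r2).
Proof.
split.
  have G i j := perm_basis i2 i j i2 pc.
  by split; [have [_ + _] := G i0 i0|have [_ + _] := G i0 i1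
            |have [_ + _] := G i1 i0|have [_ + _] := G i1 i1];
    rewrite /c; perm_simp => h; apply: (eq_by (esym h)); ring.
have H i j := perm_basis i j i2 i2 pc.
have [e00 _ f00] := H i0 i0; have [e01 _ f01] := H i0 i1.
have [e10 _ f10] := H i1 i0; have [e11 _ f11] := H i1 i1.
move: e00 f00 e01 f01 e10 f10 e11 f11; rewrite /c; perm_simp.
move=> e00 f00 e01 f01 e10 f10 e11 f11.
have z00 : l1 * (l1 - r1) = 0 by apply: (eq_by (congr2 (fun x y => y - x) e00 f00)); ring.
have z01 : l1 * (l2 - r2) = 0 by apply: (eq_by (congr2 (fun x y => y - x) e01 f01)); ring.
have z10 : l2 * (l1 - r1) = 0 by apply: (eq_by (congr2 (fun x y => y - x) e10 f10)); ring.
have z11 : l2 * (l2 - r2) = 0 by apply: (eq_by (congr2 (fun x y => y - x) e11 f11)); ring.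
have [l10|/mulfI0 l10] := eqVneq l1 0.
  have [l20|/mulfI0 l20] := eqVneq l2 0; first by left.
  by right; split; apply/eqP; rewrite -subr_eq0; apply/eqP; apply: l20.
by right; split; apply/eqP; rewrite -subr_eq0; apply/eqP; apply: l10.
Qed.

(** With s = f1 f1, comparing the first and third identities on (f1, f1, ei) gives (l_i + r_i) s =
    0. Together with l = 0 or l = r this kills both actions, and the same identities then say that s
    annihilates the even part. *)
Lemma odd_part2 : (s1, s2) != (0, 0) ->
  [/\ l1 = 0, l2 = 0, r1 = 0 & r2 = 0] /\
  [/\ A1 * s1 + B1 * s2 = 0, A2 * s1 + B2 * s2 = 0,
      C1 * s1 + D1 * s2 = 0 & C2 * s1 + D2 * s2 = 0] /\
  [/\ A1 * s1 + C1 * s2 = 0, A2 * s1 + C2 * s2 = 0,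
      B1 * s1 + D1 * s2 = 0 & B2 * s1 + D2 * s2 = 0].
Proof.
move=> nz.
have s0 x : s1 * x = 0 -> s2 * x = 0 -> x = 0.
  by move: nz; rewrite xpair_eqE negb_and => /orP[] /mulfI0 s0 e1 e2; apply: s0.
have [_ lr] := odd_part1.
have G i l := perm_basis i2 i2 i l pc.
have G' i l := perm_basis i2 i i2 l pc.
have [e00 _ f00] := G i0 i0; have [e01 _ f01] := G i0 i1.
have [e10 _ f10] := G i1 i0; have [e11 _ f11] := G i1 i1.
have [_ g00 _] := G' i0 i0; have [_ g01 _] := G' i0 i1.
have [_ g10 _] := G' i1 i0; have [_ g11 _] := G' i1 i1.
move: e00 f00 e01 f01 e10 f10 e11 f11 g00 g01 g10 g11; rewrite /c; perm_simp.
move=> e00 f00 e01 f01 e10 f10 e11 f11 g00 g01 g10 g11.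
have lr1 : l1 + r1 = 0.
  by apply: s0; [apply: (eq_by (congr2 (fun x y => x - y) e00 f00))
                |apply: (eq_by (congr2 (fun x y => x - y) e01 f01))]; ring.
have lr2 : l2 + r2 = 0.
  by apply: s0; [apply: (eq_by (congr2 (fun x y => x - y) e10 f10))
                |apply: (eq_by (congr2 (fun x y => x - y) e11 f11))]; ring.
have [z1 z2 z3 z4] : [/\ l1 = 0, l2 = 0, r1 = 0 & r2 = 0].
  case: lr => [[z1 z2]|[z1 z2]].
    by move: lr1 lr2; rewrite z1 z2 !add0r.
  move/eqP: lr1; rewrite addr_eq0 z1 => /eqP/eqN_eq0 z3.
  by move/eqP: lr2; rewrite addr_eq0 z2 => /eqP/eqN_eq0 z4.
move: e00 e01 e10 e11 g00 g01 g10 g11.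
rewrite z1 z2 z3 z4 !(mulr0, mul0r, subr0, sub0r, oppr0) => e00 e01 e10 e11 g00 g01 g10 g11.
split=> //; split; split.
- by first [apply: (eq_by g00); ring|apply: (eq_by (esym g00)); ring].
- by first [apply: (eq_by g01); ring|apply: (eq_by (esym g01)); ring].
- by first [apply: (eq_by g10); ring|apply: (eq_by (esym g10)); ring].
- by first [apply: (eq_by g11); ring|apply: (eq_by (esym g11)); ring].
- by first [apply: (eq_by e00); ring|apply: (eq_by (esym e00)); ring].
- by first [apply: (eq_by e01); ring|apply: (eq_by (esym e01)); ring].
- by first [apply: (eq_by e10); ring|apply: (eq_by (esym e10)); ring].
- by first [apply: (eq_by e11); ring|apply: (eq_by (esym e11)); ring].
Qed.

Lemma perm_cases : [\/ right_unital_case c, commutative_case c | odd_square_case c].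
Proof.
have solve (a x b y : CC) : a != 0 -> x * a + y * b = 0 -> x = - (y * b) / a.
  move=> a0 /eqP; rewrite addr_eq0 => /eqP <-; by rewrite mulfK.
have [sz|nz] := eqVneq (s1, s2) (0, 0); last first.
  apply: Or33; have [[z1 z2 z3 z4] [[g1 g2 g3 g4] [e1 e2 e3 e4]]] := odd_part2 nz.
  (* If the even product is x y = l(y) x, a nonzero annihilating vector forces l = 0, and the
     product is zero, hence commutative. *)
  have [E1 E2] : B1 = C1 /\ B2 = C2.
    case: even_part => // -[z5 z6 z7 z8 [z9 z10]].
    have s0 x : s1 * x = 0 -> s2 * x = 0 -> x = 0.
      by move: nz; rewrite xpair_eqE negb_and => /orP[] /mulfI0 s0 ? ?; apply: s0.
    have b0 : B1 = 0.
      move: e3 e4; rewrite z6 z8 z10 !(mul0r, addr0, add0r) ![B1 * _]mulrC.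
      exact: s0.
    have a0 : A1 = 0.
      move: e1 e2; rewrite z5 z7 z9 !(mul0r, addr0, add0r) ![A1 * _]mulrC.
      exact: s0.
    by rewrite b0 z6 z7 z9 a0.
  move: e1 e2 e3 e4; rewrite -E1 -E2 => e1 e2 e3 e4.
  rewrite /c z1 z2 z3 z4 -E1 -E2.
  (* In [odd_square] the square of f1 is (-q, p), so p = s2 and q = -s1; the vector w is then read
     off from e1 e1 or e2 e2. *)
  have [s10|s10] := eqVneq s1 0.
    have s20 : s2 != 0 by move: nz; rewrite s10 xpair_eqE eqxx.
    move: e1 e2 e3 e4; rewrite s10 !mulr0 !add0r => e1 e2 e3 e4.
    have {}e1 := mulfI0 s20 (etrans (mulrC _ _) e1).
    have {}e2 := mulfI0 s20 (etrans (mulrC _ _) e2).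
    have {}e3 := mulfI0 s20 (etrans (mulrC _ _) e3).
    have {}e4 := mulfI0 s20 (etrans (mulrC _ _) e4).
    exists s2, 0, (A1 / s2 ^+ 2), (A2 / s2 ^+ 2).
    by rewrite /odd_square e1 e2 e3 e4; congr mk; field.
  have {}e1 := solve _ _ _ _ s10 e1; have {}e2 := solve _ _ _ _ s10 e2.
  have {}e3 := solve _ _ _ _ s10 e3; have {}e4 := solve _ _ _ _ s10 e4.
  exists s2, (- s1), (D1 / s1 ^+ 2), (D2 / s1 ^+ 2).
  by rewrite /odd_square e1 e2 e3 e4; congr mk; field.
case: sz => z1 z2; have [[h1 h2 h2' h3] lr] := odd_part1.
case: even_part => [[E1 E2]|[z3 z4 z5 z6 [z7 z8]]]; last first.
  apply: Or31; move: h1 h2 h2' h3; rewrite z3 z4 z5 z6 z7 z8 !(mul0r, add0r, addr0).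
  move=> h1 h2 h2' h3.
  have [r12|nr] := eqVneq (r1, r2) (0, 0).
    case: r12 => zr1 zr2; exists 0, 0, A1, B1; split; first by apply: Or31.
    have [z9 z10] : l1 = 0 /\ l2 = 0 by case: lr => -[-> ->].
    by rewrite /c /right_unital z9 z10 ?zr1 ?zr2 z1 z2 z3 z4 z5 z6 z7 z8; congr mk; ring.
  (* A nonzero character of the product x y = l(y) x is equal to l. *)
  have s0 x y : r1 * x = r1 * y -> r2 * x = r2 * y -> x = y.
    by move: nr; rewrite xpair_eqE negb_and => /orP[] /mulfI s0 ? ?; apply: s0.
  have E1 : A1 = r1 by apply: s0; [apply: (eq_by h1)|apply: (eq_by h2')]; ring.
  have E2 : B1 = r2 by apply: s0; [apply: (eq_by h2)|apply: (eq_by h3)]; ring.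
  case: lr => -[y1 y2].
    exists 0, 1, A1, B1; split; first by apply: Or32.
    by rewrite /c /right_unital y1 y2 z1 z2 z3 z4 z5 z6 z7 z8 E1 E2; congr mk; ring.
  exists 1, 1, A1, B1; split; first by apply: Or33.
  by rewrite /c /right_unital y1 y2 z1 z2 z3 z4 z5 z6 z7 z8 E1 E2; congr mk; ring.
apply: Or32.
have as_ i j k l (h : [/\ par i = false, par j = false & par k = false])
  (e : [\/ i = j, j = k | i = k]) := @even_assoc c i j k l pc h e.
have a001 l := @as_ i0 i0 i1 l (And3 erefl erefl erefl) (Or31 _ _ erefl).
have a011 l := @as_ i0 i1 i1 l (And3 erefl erefl erefl) (Or32 _ _ erefl).
have ca : comm_assoc A1 A2 B1 B2 D1 D2.
  move: (a001 i0) (a001 i1) (a011 i0); rewrite /c; perm_simp.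
  move=> k1 k2 k3; split.
  - by apply: (eq_by k1); ring.
  - by apply: (eq_by k2); ring.
  - by apply: (eq_by (esym k3)); ring.
have [u [u01 [e1 e2]]] : exists u, (u = 0 \/ u = 1) /\ (l1 = u * r1 /\ l2 = u * r2).
  case: lr => lr; [exists 0|exists 1]; rewrite ?mul0r ?mul1r; split; by [left|right|].
exists u, A1, A2, B1, B2, D1, D2, r1, r2; split=> //.
by rewrite /c /commutative e1 e2 -E1 -E2 z1 z2.
Qed.

End Cases.

Lemma PermVar_cases c : PermVar c ->
  [\/ right_unital_case c, commutative_case c | odd_square_case c].
Proof. by move=> [/even_mk -> /perm_cases]. Qed.

(** * Every structure lies in one of the seven orbit closures *)

(** Two independent characters are the coordinates of an isomorphism of the even plane with C x C;
    the first one governs the odd part. *)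
Lemma orbit_characters u v A1 A2 B1 B2 D1 D2 p q r s :
  character A1 A2 B1 B2 D1 D2 p q -> character A1 A2 B1 B2 D1 D2 r s ->
  p * s - q * r != 0 ->
  gorbit (RS u v) (mk A1 A2 B1 B2 B1 B2 D1 D2 (u * p) (u * q) (v * p) (v * q) 0 0).
Proof.
move=> [h1 h2 h3] [k1 k2 k3] nz; apply/gorbit_hm; exists p, q, r, s, 1.
split; first by rewrite mulr1.
rewrite /RS; hom_tac; rewrite !(mul0r, mulr0, addr0, add0r, mul1r, mulr1) //;
  first [ring | by rewrite 1?mulrC ?h1 ?h2 ?h3 ?k1 ?k2 ?k3; ring
  | by rewrite ![p * _]mulrC ![q * _]mulrC ?h1 ?h2 ?h3; ring
  | by rewrite ![r * _]mulrC ![s * _]mulrC ?k1 ?k2 ?k3; ring].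
Qed.

Lemma orbit_characters1 u A1 A2 B1 B2 D1 D2 p q r s :
  character A1 A2 B1 B2 D1 D2 p q -> character A1 A2 B1 B2 D1 D2 r s ->
  p * s - q * r != 0 -> gorbit (RS u 1) (commutative u A1 A2 B1 B2 D1 D2 p q).
Proof.
by move=> c1 c2 nz; have := orbit_characters u 1 c1 c2 nz; rewrite !mul1r.
Qed.

Lemma quadratic_roots (a b : CC) : exists z1 z2, z1 + z2 = a /\ z1 * z2 = b.
Proof.
pose k : CC := sqrtC (a ^+ 2 - 4 * b); have kE : k ^+ 2 = a ^+ 2 - 4 * b by exact: sqrtCK.
have n2 : (2 : CC) != 0 by rewrite pnatr_eq0.
exists ((a + k) / 2), ((a - k) / 2); split; first by field.
apply: (eq_by (congr1 (fun z => - z / 4) kE)); by field.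
Qed.

(** Vanishing minors mean rank at most 1, so the 3x2 matrix is a column u times a row v. The cases
    look for a nonzero pivot entry. This parametrizes the commutative associative planes by A^5. *)
Lemma comm_assoc_rank1 A1 A2 B1 B2 D1 D2 : comm_assoc A1 A2 B1 B2 D1 D2 ->
  exists u1 u2 u3 v1 v2,
    [/\ A2 = u1 * v1, B2 = u1 * v2, B1 = u2 * v1, D1 = u2 * v2 &
        A1 = u1 * v2 - u3 * v1 /\ D2 = u2 * v1 + u3 * v2].
Proof.
move=> [m1 m2 m3].
have sol (a x b y z : CC) : a != 0 -> a * x = y * z -> x = y / a * z.
  by move=> a0 e; apply: (mulfI a0); rewrite e; field.
suff [u1 [u2 [u3 [v1 [v2 [-> -> -> -> [e5 e6]]]]]]] : exists u1 u2 u3 v1 v2,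
    [/\ A2 = u1 * v1, B2 = u1 * v2, B1 = u2 * v1, D1 = u2 * v2 &
        B2 - A1 = u3 * v1 /\ D2 - B1 = u3 * v2].
  exists u1, u2, u3, v1, v2; split=> //; split.
    by rewrite -e5; ring.
  by rewrite -e6; ring.
have [A20|nA2] := eqVneq A2 0; last first.
  exists 1, (B1 / A2), ((B2 - A1) / A2), A2, B2; rewrite !mul1r !divfK //; split=> //.
    exact: sol.
  by split=> //; apply: sol; rewrite // m2 mulrC.
have [B20|nB2] := eqVneq B2 0; last first.
  exists 1, (D1 / B2), ((D2 - B1) / B2), A2, B2; rewrite !mul1r !divfK //; split=> //.
    by apply: sol; rewrite // mulrC -m1 mulrC.
  by split=> //; apply: sol; rewrite // -m2 mulrC.
have [B10|nB1] := eqVneq B1 0; last first.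
  exists 0, 1, ((B2 - A1) / B1), B1, D1; rewrite !mul1r !mul0r !divfK //; split=> //.
  by split=> //; apply: sol; rewrite // m3 mulrC.
have [D10|nD1] := eqVneq D1 0; last first.
  exists 0, 1, ((D2 - B1) / D1), B1, D1; rewrite !mul1r !mul0r !divfK //; split=> //.
  by split=> //; apply: sol; rewrite // -m3 mulrC.
by exists 0, 0, 1, (B2 - A1), (D2 - B1); rewrite !mul0r !mul1r.
Qed.

(** The two characters come from the roots z1, z2 of z^2 - u3 z - u1 u2. Their determinant is z2 -
    z1 times the second factor of the hypothesis, and the first factor is (z1 - z2)^2. *)
Lemma rank1_characters u1 u2 u3 v1 v2 :
  (u3 ^+ 2 + 4 * u1 * u2) * (u1 * v2 ^+ 2 - u3 * v1 * v2 - u2 * v1 ^+ 2) != 0 ->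
  exists p q r s, let ch := character (u1 * v2 - u3 * v1) (u1 * v1) (u2 * v1) (u1 * v2)
                               (u2 * v2) (u2 * v1 + u3 * v2) in
    [/\ ch p q, ch r s & p * s - q * r != 0].
Proof.
have [z1 [z2 [zD zM]]] := quadratic_roots u3 (- (u1 * u2)); move=> nz.
exists (u1 * v2 - z2 * v1), (u2 * v1 + z1 * v2), (u1 * v2 - z1 * v1), (u2 * v1 + z2 * v2).
split.
- by split; rewrite -?zD; [apply: (eq_by (congr1 (fun z => v1 * v1 * z) zM))
    |apply: (eq_by (congr1 (fun z => v1 * v2 * z) zM))
    |apply: (eq_by (congr1 (fun z => v2 * v2 * z) zM))]; ring.
- by split; rewrite -?zD; [apply: (eq_by (congr1 (fun z => v1 * v1 * z) zM))
    |apply: (eq_by (congr1 (fun z => v1 * v2 * z) zM))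
    |apply: (eq_by (congr1 (fun z => v2 * v2 * z) zM))]; ring.
- apply: contraNneq nz => d0; rewrite (_ : _ * _ =
   (z2 - z1) * ((u1 * v2 - z2 * v1) * (u2 * v1 + z2 * v2)
             - (u2 * v1 + z1 * v2) * (u1 * v2 - z1 * v1))); first by rewrite d0 mulr0.
  rewrite -zD; apply: (eq_by (congr1 (fun z => 4 * (u1 * v2 ^+ 2 - (z1 + z2) * v1 * v2 - u2 * v1 ^+ 2) * z) zM)).
  by ring.
Qed.

Lemma zclosure_comm_assoc A1 A2 B1 B2 D1 D2 : comm_assoc A1 A2 B1 B2 D1 D2 ->
  zclosure (gorbit (RS 0 0)) (mk A1 A2 B1 B2 B1 B2 D1 D2 0 0 0 0 0 0).
Proof.
case/comm_assoc_rank1 => u1 [u2 [u3 [v1 [v2 [-> -> -> -> [-> ->]]]]]].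
pose phi (x : nat -> CC) := mk (x 0 * x 4 - x 2 * x 3) (x 0 * x 3) (x 1 * x 3) (x 0 * x 4)
  (x 1 * x 3) (x 0 * x 4) (x 1 * x 4) (x 1 * x 3 + x 2 * x 4) 0 0 0 0 0 0.
pose D (x : nat -> CC) := (x 2 * x 2 + 4 * x 0 * x 1) *
  (x 0 * (x 4 * x 4) - x 2 * x 3 * x 4 - x 1 * (x 3 * x 3)).
have pphi : polymap 5 phi by apply: polymap_mk; polp_tac.
have pD : polp 5 D by rewrite /D; polp_tac.
apply: (@image_dense 5 phi D _ (fun i => (2 <= i)%:R) pphi pD).
- by rewrite /D /= !(mulr0, mul0r, addr0, add0r, mulr1, mul1r, sub0r, subr0) ?mulr1n oppr_eq0 oner_eq0.
- move=> x /rank1_characters[p [q [r [s [c1 c2 nz]]]]].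
  by have := orbit_characters 0 0 c1 c2 nz; rewrite !mul0r.
- by exists (fun i => nth 0 [:: u1; u2; u3; v1; v2] i).
Qed.

(* With [e = (x, y)], [w = (- r2, r1)] and [m] such that [m e = 0], [m w = 1], this is
   the product [e e = e + g w], [e w = al w], [w w = be w] together with the character [r]. *)
Definition adapted (u r1 r2 x y al be g : CC) : struct :=
  let w11 := r1 * r1 * g - 2 * r1 * y * al + y * y * be in
  let w12 := r1 * r2 * g + (r1 * x - y * r2) * al - y * x * be in
  let w22 := r2 * r2 * g + 2 * r2 * x * al + x * x * be in
  mk (r1 * r1 * x - w11 * r2) (r1 * r1 * y + w11 * r1)
     (r1 * r2 * x - w12 * r2) (r1 * r2 * y + w12 * r1)
     (r1 * r2 * x - w12 * r2) (r1 * r2 * y + w12 * r1)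
     (r2 * r2 * x - w22 * r2) (r2 * r2 * y + w22 * r1)
     (u * r1) (u * r2) r1 r2 0 0.

(** The second character is al r + be m, with value [al] at e and [be] at w. Multiplicativity on e e
    is the equation [al + g * be = al ^+ 2], and it is independent of r because [be] is nonzero. *)
Lemma adapted_orbit u r1 r2 x y al be g :
  r1 * x + r2 * y = 1 -> al + g * be = al ^+ 2 -> be != 0 ->
  gorbit (RS u 1) (adapted u r1 r2 x y al be g).
Proof.
move=> re ha be0.
apply: (orbit_characters1 _ (r := al * r1 - be * y) (s := al * r2 + be * x)).
- by split; [apply: (eq_by (congr1 (fun z => r1 * r1 * z) re))
  |apply: (eq_by (congr1 (fun z => r1 * r2 * z) re))
  |apply: (eq_by (congr1 (fun z => r2 * r2 * z) re))]; ring.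
- split.
  + apply: (eq_by (congr2 (fun a b => (al * (r1 * r1) + be *
      (r1 * r1 * g - 2 * r1 * y * al + y * y * be)) * a + r1 * r1 * b) re ha)); ring.
  + apply: (eq_by (congr2 (fun a b => (al * (r1 * r2) + be *
      (r1 * r2 * g + (r1 * x - y * r2) * al - y * x * be)) * a + r1 * r2 * b) re ha)); ring.
  + apply: (eq_by (congr2 (fun a b => (al * (r2 * r2) + be *
      (r2 * r2 * g + 2 * r2 * x * al + x * x * be)) * a + r2 * r2 * b) re ha)); ring.
- have -> : r1 * (al * r2 + be * x) - r2 * (al * r1 - be * y) = be * (r1 * x + r2 * y) by ring.
  by rewrite re mulr1.
Qed.

Lemma zclosure_adapted u r1 r2 x y al be g :
  r1 * x + r2 * y = 1 -> al + g * be = al ^+ 2 ->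
  zclosure (gorbit (RS u 1)) (adapted u r1 r2 x y al be g).
Proof.
move=> re ha; have [b0|be0] := eqVneq be 0; last first.
  by apply: sub_zclosure; apply: adapted_orbit.
move: ha; rewrite b0 mulr0 addr0 => ha.
(* Since al^2 = al, one has (2 al - 1)^2 = 1, so this curve keeps the equation between the
   parameters while [be] becomes the nonzero value [z 0]. *)
pose phi (z : nat -> CC) := adapted u r1 r2 x y
  (al + (2 * al - 1) * g * z 0) (z 0) (g + g * g * z 0).
have pphi : polymap 1 phi by apply: polymap_mk; polp_tac.
have pD : polp 1 (fun z => z 0%N) by polp_tac.
apply: (@image_dense 1 phi (fun z => z 0%N) _ (fun _ => 1) pphi pD).
- exact: oner_neq0.
- move=> z z0; apply: adapted_orbit => //.
  apply: (eq_by (congr1 (fun a => (1 + 4 * g * z 0 + 4 * g ^+ 2 * z 0 ^+ 2) * a) ha)).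
  by ring.
- by exists (fun _ => 0); rewrite /phi !mulr0 !addr0.
Qed.

Lemma commutative_adapted u A1 A2 B1 B2 D1 D2 r1 r2 :
  comm_assoc A1 A2 B1 B2 D1 D2 -> character A1 A2 B1 B2 D1 D2 r1 r2 ->
  (r1, r2) != (0, 0) -> exists x y al be g,
  [/\ r1 * x + r2 * y = 1, al + g * be = al ^+ 2 &
      commutative u A1 A2 B1 B2 D1 D2 r1 r2 = adapted u r1 r2 x y al be g].
Proof.
move=> [m1 m2 m3] [c1 c2 c3] nz.
have solve (a x y z : CC) : a != 0 -> x * a + y = z -> x = (z - y) / a.
  by move=> a0 <-; rewrite addrK mulfK.
(* Take e to be a multiple of a coordinate vector with r(e) = 1. Then [g], [al], [be] are the
   w-coordinates of e e, e w, w w, and their relation is one of the associativity minors. *)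
have [r10|r10] := eqVneq r1 0.
  have r20 : r2 != 0 by move: nz; rewrite r10 xpair_eqE eqxx.
  pose g := - D1 / r2 ^+ 3; pose al := r1 * r2 * g + B1 / r2.
  pose be := r2 ^+ 2 * (- A1 / r2 - r1 ^+ 2 * g + 2 * r1 * al / r2).
  have {}c1 := solve _ _ _ _ r20 (etrans (addrC _ _) c1).
  have {}c2 := solve _ _ _ _ r20 (etrans (addrC _ _) c2).
  have {}c3 := solve _ _ _ _ r20 (etrans (addrC _ _) c3).
  exists 0, r2^-1, al, be, g; split; first by field.
    apply: (eq_by (congr1 (fun z => z / r2 ^+ 2) m3)); rewrite /be /al /g c2 c3; by field.
  by rewrite /commutative /adapted /be /al /g c1 c2 c3; congr mk; field.
pose g := A2 / r1 ^+ 3; pose al := B2 / r1 - r2 * A2 / r1 ^+ 2.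
pose be := r1 ^+ 2 * (D2 / r1 - r2 ^+ 2 * g - 2 * r2 * al / r1).
have {}c1 := solve _ _ _ _ r10 c1.
have {}c2 := solve _ _ _ _ r10 c2.
have {}c3 := solve _ _ _ _ r10 c3.
exists r1^-1, 0, al, be, g; split; first by field.
  apply: (eq_by (congr1 (fun z => z / r1 ^+ 2) m2)); rewrite /be /al /g c1 c2; by field.
by rewrite /commutative /adapted /be /al /g c1 c2 c3; congr mk; field.
Qed.

Lemma PermVar_cover c : PermVar c -> exists i, zclosure (gorbit (Rlist i)) c.
Proof.
have [R1 R2 R3 R4 [R5 R6 R7]] := RlistE.
have ex i R d : Rlist i = R -> zclosure (gorbit R) d ->
  exists i, zclosure (gorbit (Rlist i)) d by move=> <-; exists i.
case/PermVar_cases => [[u [v [p [q [uv ->]]]]]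
  |[u [A1 [A2 [B1 [B2 [D1 [D2 [r1 [r2 [u01 ca ch ->]]]]]]]]]]|[p [q [w1 [w2 ->]]]]].
- have L : zclosure (gorbit (RU u v)) (right_unital u v p q).
    by rewrite zclosure_RU; apply: sub_zclosure; exists (fun i => nth 0 [:: p; q] i).
  by case: uv L => -[-> ->]; [apply: ex R5|apply: ex R6|apply: ex R7].
- have [[r10 r20]|nz] := eqVneq (r1, r2) (0, 0).
    by apply: (ex _ _ _ R1); rewrite /commutative r10 r20 mulr0; apply: zclosure_comm_assoc.
  have [x [y [al [be [g [re ha ->]]]]]] := commutative_adapted u ca ch nz.
  have := zclosure_adapted (u := u) re ha.
  by case: u01 => ->; [apply: ex R3|apply: ex R2].
- apply: (ex _ _ _ R4); rewrite zclosure_RQ; apply: sub_zclosure.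
  by exists (fun i => nth 0 [:: p; q; w1; w2] i).
Qed.

(** * The seven algebras and their orbit closures lie in the variety *)

Definition vec3 (a b c : CC) : vec := fun k => nth 0 [:: a; b; c] k.

Lemma vec3_ext (x y : vec) : x i0 = y i0 -> x i1 = y i1 -> x i2 = y i2 -> x = y.
Proof. by move=> h0 h1 h2; apply/funext; apply: ord3_ind. Qed.

Lemma mul_RS u v x y : mul (RS u v) x y =
  vec3 (x i0 * y i0) (x i1 * y i1) (u * x i0 * y i2 + v * x i2 * y i0).
Proof. by apply: vec3_ext; rewrite /mul !sum3 /RS /mk /vec3 /=; ring. Qed.

Lemma mul_RU u v x y : mul (RU u v) x y =
  vec3 (x i0 * y i0) (x i1 * y i0) (u * x i0 * y i2 + v * x i2 * y i0).
Proof. by apply: vec3_ext; rewrite /mul !sum3 /RU /mk /vec3 /=; ring. Qed.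

Lemma mul_RQ x y : mul RQ x y = vec3 (x i0 * y i0) (x i2 * y i2) 0.
Proof. by apply: vec3_ext; rewrite /mul !sum3 /RQ /mk /vec3 /=; ring. Qed.

Lemma homogE a x : homog a x -> if a then x = vec3 0 0 (x i2) else x = vec3 (x i0) (x i1) 0.
Proof. by case: a => h; apply: vec3_ext => //; apply: h. Qed.

Ltac perm_tac mulE :=
  move=> [] [] [] x y z /homogE-> /homogE-> /homogE->;
  split; apply: vec3_ext; rewrite /assoc /vadd /vscale !mulE /vec3 /sgn /=; ring.

Lemma PermVar_RS u v : [\/ (u, v) = (0, 0), (u, v) = (1, 1) | (u, v) = (0, 1)] ->
  PermVar (RS u v).
Proof.
move=> uv; split; first exact: mk_even.
by case: uv => -[-> ->]; perm_tac mul_RS.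
Qed.

Lemma PermVar_RU u v : [\/ (u, v) = (0, 0), (u, v) = (0, 1) | (u, v) = (1, 1)] ->
  PermVar (RU u v).
Proof.
move=> uv; split; first exact: mk_even.
by case: uv => -[-> ->]; perm_tac mul_RU.
Qed.

Lemma PermVar_RQ : PermVar RQ.
Proof. by split; [exact: mk_even|perm_tac mul_RQ]. Qed.

Lemma ord7_ind (P : 'I_7 -> Prop) :
  P (@Ordinal 7 0 isT) -> P (@Ordinal 7 1 isT) -> P (@Ordinal 7 2 isT) ->
  P (@Ordinal 7 3 isT) -> P (@Ordinal 7 4 isT) -> P (@Ordinal 7 5 isT) ->
  P (@Ordinal 7 6 isT) -> forall i, P i.
Proof.
move=> P0 P1 P2 P3 P4 P5 P6 i; have e (j : 'I_7) : val i = val j -> P j -> P i.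
  by move=> /val_inj ->.
case: i e => -[|[|[|[|[|[|[|i]]]]]]] hi e //.
- exact: e P0.
- exact: e P1.
- exact: e P2.
- exact: e P3.
- exact: e P4.
- exact: e P5.
- exact: e P6.
Qed.

Lemma PermVar_Rlist i : PermVar (Rlist i).
Proof.
have [R1 R2 R3 R4 [R5 R6 R7]] := RlistE.
move: i; apply: ord7_ind; rewrite ?(R1, R2, R3, R4, R5, R6, R7);
  first [exact: PermVar_RQ | apply: PermVar_RS | apply: PermVar_RU];
  by [apply: Or31|apply: Or32|apply: Or33].
Qed.

Lemma even_orbit i d : gorbit (Rlist i) d -> even_struct d.
Proof.
have [R1 R2 R3 R4 [R5 R6 R7]] := RlistE.
move: i; apply: ord7_ind; rewrite ?(R1, R2, R3, R4, R5, R6, R7);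
  first [ by case/orbit_semisimple => p [q [r [s [_ ->]]]]; apply: mk_even
  | by case/orbit_right_unital => p [q [_ ->]]; apply: mk_even
  | by case/orbit_odd_square => p [q [w1 [w2 [_ ->]]]]; apply: mk_even].
Qed.

Lemma PermVar_orbit i d : gorbit (Rlist i) d -> PermVar d.
Proof.
move=> id; split; first exact: even_orbit id.
have /gorbitP[h gh H] := id.
by apply: perm_identities_hom gh H _; case: (PermVar_Rlist i).
Qed.

Lemma zclosure_PermVar i : subs (zclosure (gorbit (Rlist i))) PermVar.
Proof.
apply: zclosure_min; first exact: PermVar_closed.
by move=> d; apply: PermVar_orbit.
Qed.

(** * Separating the orbit closures *)

(* [tl], [tr] are the traces on the even part of left and right multiplications, and
   [lf], [rf] the eigenvalues of the left and right actions on [f1].  When [rf] is a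
   nonzero character of a commutative even part, [res] is its second character. *)
Definition tl (c : struct) (i : 'I_3) := c i i0 i0 + c i i1 i1.
Definition tr (c : struct) (i : 'I_3) := c i0 i i0 + c i1 i i1.
Definition lf (c : struct) (i : 'I_3) := c i i2 i2.
Definition rf (c : struct) (i : 'I_3) := c i2 i i2.
Definition comm (c : struct) (k : 'I_3) := c i0 i1 k - c i1 i0 k.

Definition on_product (f : struct -> 'I_3 -> CC) (c : struct) (i j : 'I_3) :=
  c i j i0 * f c i0 + c i j i1 * f c i1.

Definition res (c : struct) (i : 'I_3) := tl c i - rf c i.
(** The failure of [res] to be multiplicative. *)
Definition mult (c : struct) (i j : 'I_3) := on_product res c i j - res c i * res c j.
(** For a commutative even part, the Gram determinant of the trace form (x, y) -> tl(x y). *)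
Definition disc (c : struct) := on_product tl c i0 i0 * on_product tl c i1 i1
  - on_product tl c i0 i1 * on_product tl c i0 i1.

Ltac polyfun_tac :=
  repeat first [apply: pf_coord | apply: pf_cst | apply: polyfunN | apply: pf_add
               | apply: pf_mul].

(** The condition on the square lets the test take the value 1 or -1 at [S]. *)
Lemma separate R (phi : (nat -> CC) -> struct) S f :
  zclosure (gorbit R) = zclosure (img phi) -> f S * f S = 1 -> polyfun f ->
  (forall x, f (phi x) = 0) -> ~ zclosure (gorbit R) S.
Proof.
move=> -> f1 pf f0 /(zclosure_zero pf); rewrite (_ : f S = 0 <-> False); last first.
  split=> // z; move/eqP: f1; by rewrite z mul0r eq_sym oner_eq0.
by apply=> _ [x ->].
Qed.

Ltac unfold_tests := rewrite /disc /mult /on_product /res /comm /tl /tr /lf /rf.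

Ltac sep_tac E f := apply: (separate (f := f) E);
  [ by unfold_tests; rewrite /RS /RU /RQ /mk /=; ring
  | by unfold_tests; polyfun_tac
  | by move=> x; unfold_tests; rewrite /semisimple /right_unital /odd_square /mk /=; ring ].

Ltac sep_all E := first
  [ sep_tac E (fun c : struct => comm c i1) | sep_tac E (fun c : struct => c i2 i2 i1)
  | sep_tac E (fun c : struct => rf c i0) | sep_tac E (fun c : struct => lf c i0)
  | sep_tac E (fun c : struct => lf c i0 - rf c i0)
  | sep_tac E (fun c : struct => tr c i0 - 2 * tl c i0)
  | sep_tac E (fun c : struct => res c i0) | sep_tac E (fun c : struct => mult c i0 i1)].

(** For instance, [tr - 2 * tl] vanishes on the [RU] closures only, [res] keeps R25 out of those of
    R31 and R33, and [mult] keeps R01 out of those of R02, R04 and R10. *)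
Lemma Rlist_separated i j : i <> j -> ~ zclosure (gorbit (Rlist j)) (Rlist i).
Proof.
have [R1 R2 R3 R4 [R5 R6 R7]] := RlistE.
move: i j; apply: ord7_ind; apply: ord7_ind => // _;
  rewrite ?(R1, R2, R3, R4, R5, R6, R7);
  lazymatch goal with
  | |- ~ zclosure (gorbit (RS ?u ?v)) _ => sep_all (zclosure_RS u v)
  | |- ~ zclosure (gorbit (RU ?u ?v)) _ => sep_all (zclosure_RU u v)
  | |- ~ zclosure (gorbit RQ) _ => sep_all zclosure_RQ
  end.
Qed.

(** * Openness of the orbits *)

Lemma zopen_nonzero (X O : sset) (I : Type) (f : I -> struct -> CC) :
  (forall n, polyfun (f n)) -> (forall c, O c -> X c) ->
  (forall c, O c -> exists n, f n c != 0) ->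
  (forall c n, X c -> f n c != 0 -> O c) -> zopen_in X O.
Proof.
move=> pf OX Of fO; exists (fun c => forall n, f n c = 0).
split=> [|c]; first exact: zclosed_zeros.
split=> [Oc|[Xc /existsNP[n /eqP fn]]]; last exact: fO fn.
by split; [apply: OX|move=> z; have [n] := Of c Oc; rewrite z eqxx].
Qed.

Definition ix (b : bool) : 'I_3 := if b then i1 else i0.

Ltac unfold_fam := rewrite /semisimple /right_unital /odd_square /commutative /mk /=.

Lemma comm_right_unital c k : PermVar c -> comm c (ix k) != 0 ->
  exists u v p q, [/\ [\/ (u, v) = (0, 0), (u, v) = (0, 1) | (u, v) = (1, 1)],
    (p, q) != (0, 0) & c = right_unital u v p q].
Proof.
case/PermVar_cases => [[u [v [p [q [uv ->]]]]]
  |[u [A1 [A2 [B1 [B2 [D1 [D2 [r1 [r2 [u01 ca ch ->]]]]]]]]]]|[p [q [w1 [w2 ->]]]]].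
- move=> nz; exists u, v, p, q; split=> //; apply: contraNneq nz => -[-> ->].
  by case: k; rewrite /comm; unfold_fam; rewrite subrr.
- by case: k; rewrite /comm; unfold_fam; rewrite subrr eqxx.
- by case: k; rewrite /comm; unfold_fam; rewrite subrr eqxx.
Qed.

(** A nonzero commutator selects the family x y = l(y) x with l nonzero, and [f] selects the pair
    (u, v). The commutator is q e1 - p e2, so different points of the orbit need different
    coordinates of both tests. *)
Lemma open_RU u v f : [\/ (u, v) = (0, 0), (u, v) = (0, 1) | (u, v) = (1, 1)] ->
  (forall i, polyfun (fun c => f c i)) -> (forall c, gorbit (RU u v) c -> PermVar c) ->
  (forall p q i, f (right_unital u v p q) (ix i) = 0 -> (if i then q else p) = 0) ->
  (forall u' v' p q i, [\/ (u', v') = (0, 0), (u', v') = (0, 1) | (u', v') = (1, 1)] ->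
    f (right_unital u' v' p q) (ix i) != 0 -> (u', v') = (u, v)) ->
  zopen_in PermVar (gorbit (RU u v)).
Proof.
move=> uv pf OX f0 f1.
apply: (@zopen_nonzero _ _ (bool * bool) (fun n c => comm c (ix n.1) * f c (ix n.2))) => //.
- move=> n; apply: pf_mul => //; rewrite /comm; polyfun_tac.
- move=> c /orbit_right_unital[p [q [nz ->]]].
  have [p0|p0] := eqVneq p 0.
    have q0 : q != 0 by move: nz; rewrite p0 xpair_eqE eqxx.
    exists (false, true); rewrite mulf_neq0 //=; last first.
      by apply/eqP => z; move: (f0 p q true z); apply/eqP.
    by rewrite /comm; unfold_fam; rewrite subr0.
  exists (true, false); rewrite mulf_neq0 //=; last first.
    by apply/eqP => z; move: (f0 p q false z); apply/eqP.
  by rewrite /comm; unfold_fam; rewrite sub0r oppr_eq0.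
- move=> c [k i] Xc /=; rewrite mulf_eq0 negb_or => /andP[ck fi].
  have [u' [v' [p [q [uv' nz E]]]]] := comm_right_unital Xc ck.
  by move: fi; rewrite E => /f1 => /(_ uv')[-> ->]; apply: right_unital_orbit.
Qed.

(** A nonzero odd square selects the family [odd_square], on which [tl] is l(w) l; it is nonzero
    only if l(w) is, the condition for lying in the orbit. *)
Lemma open_RQ : (forall c, gorbit RQ c -> PermVar c) -> zopen_in PermVar (gorbit RQ).
Proof.
move=> OX.
apply: (@zopen_nonzero _ _ (bool * bool) (fun n c => c i2 i2 (ix n.1) * tl c (ix n.2))) => //.
- by move=> n; unfold_tests; polyfun_tac.
- move=> c /orbit_odd_square[p [q [w1 [w2 [nz ->]]]]].
  have [p0|p0] := eqVneq p 0.
    have q0 : q != 0 by apply: contraNneq nz => ->; rewrite p0 !mul0r addr0.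
    exists (false, true); rewrite /=; unfold_tests; unfold_fam.
    rewrite (_ : _ * _ = - q * (q * (p * w1 + q * w2))); last by ring.
    by rewrite !mulf_neq0 ?oppr_eq0.
  exists (true, false); rewrite /=; unfold_tests; unfold_fam.
  rewrite (_ : _ * _ = p * (p * (p * w1 + q * w2))); last by ring.
  by rewrite !mulf_neq0.
- move=> c n; case/PermVar_cases => [[u [v [p [q [uv ->]]]]]
  |[u [A1 [A2 [B1 [B2 [D1 [D2 [r1 [r2 [u01 ca ch ->]]]]]]]]]]|[p [q [w1 [w2 ->]]]]].
  + by case: n => -[] ? /=; unfold_fam; rewrite mul0r eqxx.
  + by case: n => -[] ? /=; unfold_fam; rewrite mul0r eqxx.
  + rewrite mulf_eq0 negb_or => /andP[_ nz]; apply: odd_square_orbit.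
    apply: contraNneq nz => z; case: n.2; unfold_tests; unfold_fam.
      have -> : p * q * w1 + q * q * w2 = q * (p * w1 + q * w2) by ring.
      by rewrite z mulr0.
    have -> : p * p * w1 + p * q * w2 = p * (p * w1 + q * w2) by ring.
    by rewrite z mulr0.
Qed.

(** The kernel of r is an ideal, and multiplication by x acts as r(x) on the quotient. On the
    kernel, a line when r is nonzero, it therefore acts by its trace minus r(x), which is
    multiplicative by associativity. *)
Lemma second_character A1 A2 B1 B2 D1 D2 r1 r2 :
  comm_assoc A1 A2 B1 B2 D1 D2 -> character A1 A2 B1 B2 D1 D2 r1 r2 ->
  (r1, r2) != (0, 0) ->
  character A1 A2 B1 B2 D1 D2 (A1 + B2 - r1) (B1 + D2 - r2).
Proof.
move=> [m1 m2 m3] [c1 c2 c3] nz.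
have solve (a x y z : CC) : a != 0 -> x * a + y = z -> x = (z - y) / a.
  by move=> a0 <-; rewrite addrK mulfK.
have [r10|r10] := eqVneq r1 0.
  have r20 : r2 != 0 by move: nz; rewrite r10 xpair_eqE eqxx.
  have e1 := solve _ _ _ _ r20 (etrans (addrC _ _) c1).
  have e2 := solve _ _ _ _ r20 (etrans (addrC _ _) c2).
  have e3 := solve _ _ _ _ r20 (etrans (addrC _ _) c3).
  move: m1 m2 m3; rewrite e1 e2 e3 => m1 m2 m3; split.
  - apply: (eq_by (congr1 (fun z => z * (r1 / r2) ^+ 2) m3)); by field.
  - apply: (eq_by (congr1 (fun z => z * (r1 / r2)) m3)); by field.
  - by apply: (eq_by m3); field.
have e1 := solve _ _ _ _ r10 c1.
have e2 := solve _ _ _ _ r10 c2.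
have e3 := solve _ _ _ _ r10 c3.
move: m1 m2 m3; rewrite e1 e2 e3 => m1 m2 m3; split.
- by apply: (eq_by m2); field.
- apply: (eq_by (congr1 (fun z => z * (r2 / r1)) m2)); by field.
- apply: (eq_by (congr1 (fun z => z * (r2 / r1) ^+ 2) m2)); by field.
Qed.

Lemma disc_commutative c : PermVar c -> disc c != 0 ->
  exists u A1 A2 B1 B2 D1 D2 r1 r2, [/\ u = 0 \/ u = 1,
    comm_assoc A1 A2 B1 B2 D1 D2, character A1 A2 B1 B2 D1 D2 r1 r2 &
    c = commutative u A1 A2 B1 B2 D1 D2 r1 r2].
Proof.
case/PermVar_cases => [[u [v [p [q [uv ->]]]]]|//|[p [q [w1 [w2 ->]]]]].
  by rewrite (_ : disc _ = 0) ?eqxx //; unfold_tests; unfold_fam; ring.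
by rewrite (_ : disc _ = 0) ?eqxx //; unfold_tests; unfold_fam; ring.
Qed.

Lemma disc_semisimple u v p q r s :
  disc (semisimple u v p q r s) = (p * s - q * r) ^+ 6.
Proof. by unfold_tests; unfold_fam; ring. Qed.

Lemma open_RS1 u f : (u = 0 \/ u = 1) ->
  (forall i, polyfun (fun c => f c i)) -> (forall c, gorbit (RS u 1) c -> PermVar c) ->
  (forall p q r s i, f (semisimple u 1 p q r s) (ix i)
     = (p * s - q * r) * (if i then q else p)) ->
  (forall u' A1 A2 B1 B2 D1 D2 r1 r2 i, u' = 0 \/ u' = 1 ->
    f (commutative u' A1 A2 B1 B2 D1 D2 r1 r2) (ix i) != 0 ->
    u' = u /\ (r1, r2) != (0, 0)) ->
  zopen_in PermVar (gorbit (RS u 1)).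
Proof.
move=> u01 pf OX f0 f1.
apply: (@zopen_nonzero _ _ bool (fun n c => disc c * f c (ix n))) => //.
- by move=> n; apply: pf_mul => //; unfold_tests; polyfun_tac.
- move=> c /orbit_semisimple[p [q [r [s [nz ->]]]]].
  have [p0|p0] := eqVneq p 0; [exists true|exists false];
    rewrite disc_semisimple f0 !mulf_neq0 ?expf_neq0 //.
  by apply: contraNneq nz => ->; rewrite p0 !mul0r subrr.
- move=> c n Xc; rewrite mulf_eq0 negb_or => /andP[dc fc].
  have [u' [A1 [A2 [B1 [B2 [D1 [D2 [r1 [r2 [u01' ca ch E]]]]]]]]]] := disc_commutative Xc dc.
  move: dc fc; rewrite E => dc /(f1 _ _ _ _ _ _ _ _ _ _ u01')[-> nz].
  apply: (orbit_characters1 _ ch (second_character ca ch nz)).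
  apply: contraNneq dc => z; have [c1 c2 c3] := ch.
  have [k1 k2 k3] := second_character ca ch nz.
  (* The trace form is the sum of the squares of the two characters, so [disc] is the square of
     their determinant. *)
  have E1 : A1 * (A1 + B2) + A2 * (B1 + D2) = r1 * r1 + (A1 + B2 - r1) * (A1 + B2 - r1).
    by rewrite -c1 -k1; ring.
  have E2 : B1 * (A1 + B2) + B2 * (B1 + D2) = r1 * r2 + (A1 + B2 - r1) * (B1 + D2 - r2).
    by rewrite -c2 -k2; ring.
  have E3 : D1 * (A1 + B2) + D2 * (B1 + D2) = r2 * r2 + (B1 + D2 - r2) * (B1 + D2 - r2).
    by rewrite -c3 -k3; ring.
  unfold_tests; unfold_fam; rewrite E1 E2 E3.
  apply/eqP; apply: (eq_by (congr1 (fun a => a * (r1 * (B1 + D2 - r2) - r2 * (A1 + B2 - r1))) z)).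
  by ring.
Qed.

Lemma open_RS0 : (forall c, gorbit (RS 0 0) c -> PermVar c) ->
  zopen_in PermVar (gorbit (RS 0 0)).
Proof.
move=> OX.
apply: (@zopen_nonzero _ _ (bool * bool) (fun n c => disc c * mult c (ix n.1) (ix n.2))) => //.
- by move=> n; unfold_tests; polyfun_tac.
- move=> c /orbit_semisimple[p [q [r [s [nz ->]]]]].
  apply: contrapT => /forallNP all0.
  (* Here [res] is the sum of the two characters, so [mult] is minus their symmetrized product, a
     quadratic form whose discriminant is the square of their determinant and hence nonzero. *)
  have z n : mult (semisimple 0 0 p q r s) (ix n.1) (ix n.2) = 0.
    apply/eqP; have /negP := all0 n; rewrite negbK mulf_eq0 disc_semisimple.
    by rewrite expf_eq0 (negbTE nz).
  case/negP: nz; move: (z (false, false)) (z (false, true)) (z (true, true)).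
  rewrite /=; unfold_tests; unfold_fam; move=> z1 z2 z3.
  pose D := p * s - q * r.
  have y1 : 2 * D ^+ 2 * (p * r) = 0 by apply: (eq_by (esym z1)); rewrite /D; ring.
  have y2 : D ^+ 2 * (p * s + q * r) = 0 by apply: (eq_by (esym z2)); rewrite /D; ring.
  have y3 : 2 * D ^+ 2 * (q * s) = 0 by apply: (eq_by (esym z3)); rewrite /D; ring.
  have : D ^+ 6 = 0.
    rewrite (_ : _ ^+ 6 = (D ^+ 2 * (p * s + q * r)) ^+ 2
       - (2 * D ^+ 2 * (p * r)) * (2 * D ^+ 2 * (q * s))); last by rewrite /D; ring.
    by rewrite y1 y2 expr0n mul0r subrr.
  by move/eqP; rewrite expf_eq0.
- move=> c n Xc; rewrite mulf_eq0 negb_or => /andP[dc fc].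
  have [u [A1 [A2 [B1 [B2 [D1 [D2 [r1 [r2 [u01 ca ch E]]]]]]]]]] := disc_commutative Xc dc.
  have [[r10 r20]|nz] := eqVneq (r1, r2) (0, 0); last first.
    (* If the right action is nonzero, [res] is a character and every [mult] vanishes. *)
    have [k1 k2 k3] := second_character ca ch nz; case/eqP: fc; rewrite E.
    case: n => -[] [] /=; unfold_tests; unfold_fam; rewrite ?k1 ?k2 ?k3; ring.
  move: dc; rewrite E r10 r20 => dc.
  case/comm_assoc_rank1: ca dc => u1 [u2 [u3 [v1 [v2 [-> -> -> -> [-> ->]]]]]] dc.
  have nz : (u3 ^+ 2 + 4 * u1 * u2) * (u1 * v2 ^+ 2 - u3 * v1 * v2 - u2 * v1 ^+ 2) != 0.
    apply: contraNneq dc => z; unfold_tests; unfold_fam; apply/eqP.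
    apply: (eq_by (congr1 (fun a => a * (u1 * v2 ^+ 2 - u3 * v1 * v2 - u2 * v1 ^+ 2)) z)).
    by ring.
  have [p [q [r [s [c1 c2 pq]]]]] := rank1_characters nz.
  by have := orbit_characters 0 0 c1 c2 pq; rewrite /commutative !mul0r mulr0.
Qed.

Lemma open_Rlist i : zopen_in PermVar (gorbit (Rlist i)).
Proof.
have OX := @PermVar_orbit; have [R1 R2 R3 R4 [R5 R6 R7]] := RlistE.
move: i; apply: ord7_ind.
- by have := OX (Ordinal (isT : (0 < 7)%N)); rewrite R1; apply: open_RS0.
- have := OX (Ordinal (isT : (1 < 7)%N)); rewrite R2 => OX'.
  apply: (open_RS1 (f := lf)) => //; first by right.
  + by move=> i; apply: pf_coord.
  + by move=> p q r s [] /=; rewrite /lf; unfold_fam; rewrite mul1r.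
  + move=> u A1 A2 B1 B2 D1 D2 r1 r2 i [->|->] nz; move: nz; case: i; rewrite /lf; unfold_fam;
      rewrite ?mul0r ?eqxx // mul1r => nz; split=> //; rewrite xpair_eqE negb_and nz ?orbT //.
- have := OX (Ordinal (isT : (2 < 7)%N)); rewrite R3 => OX'.
  apply: (open_RS1 (f := fun c i => rf c i - lf c i)) => //; first by left.
  + by move=> i; unfold_tests; polyfun_tac.
  + by move=> p q r s [] /=; unfold_tests; unfold_fam; ring.
  + move=> u A1 A2 B1 B2 D1 D2 r1 r2 i [->|->] nz; move: nz; case: i; unfold_tests; unfold_fam;
      rewrite ?mul1r ?subrr ?eqxx // mul0r subr0 => nz; split=> //;
      rewrite xpair_eqE negb_and nz ?orbT //.
- by have := OX (Ordinal (isT : (3 < 7)%N)); rewrite R4; apply: open_RQ.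
- have := OX (Ordinal (isT : (4 < 7)%N)); rewrite R5 => OX'.
  apply: (open_RU (f := fun c i => rf c i - tl c i)) => //; first by apply: Or31.
  + by move=> i; unfold_tests; polyfun_tac.
  + by move=> p q [] /=; unfold_tests; unfold_fam;
      rewrite mul0r ?addr0 ?add0r ?sub0r => /eqP; rewrite oppr_eq0 => /eqP.
  + by move=> u v p q [] [] // [-> ->]; unfold_tests; unfold_fam;
      rewrite mul1r ?addr0 ?add0r subrr eqxx.
- have := OX (Ordinal (isT : (5 < 7)%N)); rewrite R6 => OX'.
  apply: (open_RU (f := fun c i => rf c i - lf c i)) => //; first by apply: Or32.
  + by move=> i; unfold_tests; polyfun_tac.
  + by move=> p q [] /=; unfold_tests; unfold_fam; rewrite mul0r mul1r subr0.
  + by move=> u v p q [] [] // [-> ->]; unfold_tests; unfold_fam; rewrite subrr eqxx.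
- have := OX (Ordinal (isT : (6 < 7)%N)); rewrite R7 => OX'.
  apply: (open_RU (f := lf)) => //; first by apply: Or33.
  + by move=> i; unfold_tests; polyfun_tac.
  + by move=> p q [] /=; unfold_tests; unfold_fam; rewrite mul1r.
  + by move=> u v p q [] [] // [-> ->]; unfold_tests; unfold_fam; rewrite mul0r eqxx.
Qed.

(** * Dimension, components and rigidity *)

Lemma irreducible_union (I : eqType) (s : seq I) (T : I -> sset) Z :
  irreducible_closed Z -> (forall i, zclosed (T i)) ->
  subs Z (fun x => exists2 i, i \in s & T i x) -> exists i, subs Z (T i).
Proof.
move=> irrZ cT; have [_ [z Zz] irr] := irrZ; elim: s => [|i s IH] Zs.
  by have [] := Zs z Zz.
have cU (r : seq I) : zclosed (fun x => exists2 i, i \in r & T i x).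
  elim: r => [|j r [P [PP IHr]]].
    (* The empty union is the zero set of the constant 1. *)
    exists (fun f => f = fun _ => 1); split=> [f ->|x]; first exact: pf_cst.
    by split=> [[]//|/(_ _ erefl)/eqP]; rewrite oner_eq0.
  have cr : zclosed (fun x => exists2 i, i \in r & T i x) by exists P.
  rewrite (_ : (fun x => _) = fun x => T j x \/ exists2 i, i \in r & T i x).
    exact: zclosedU.
  apply: sset_eq => x; split.
    by case=> k; rewrite inE => /orP[/eqP->|kr] Tk; [left|right; exists k].
  by case=> [Tj|[k kr Tk]]; [exists j|exists k]; rewrite // inE ?eqxx ?kr ?orbT.
have [] := irr _ _ (cT i) (cU s); last by exact: IH.
- move=> x /Zs[k]; rewrite inE => /orP[/eqP->|ks] Tk; [by left|by right; exists k].
- by exists i.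
Qed.

Lemma Rlist_image i : exists2 phi, polymap 4 phi &
  zclosure (gorbit (Rlist i)) = zclosure (img phi).
Proof.
have [R1 R2 R3 R4 [R5 R6 R7]] := RlistE.
move: i; apply: ord7_ind; rewrite ?(R1, R2, R3, R4, R5, R6, R7)
  ?zclosure_RS ?zclosure_RU ?zclosure_RQ; eexists; try reflexivity;
  by apply: polymap_mk; polp_tac.
Qed.

Lemma irreducible_Rlist i : irreducible_closed (zclosure (gorbit (Rlist i))).
Proof. by have [phi pphi ->] := Rlist_image i; apply: irreducible_image. Qed.

Lemma Rlist_sub i j :
  subs (zclosure (gorbit (Rlist i))) (zclosure (gorbit (Rlist j))) -> i = j.
Proof.
move=> sub; apply: contrapT => /Rlist_separated; apply; apply: sub.
by apply: sub_zclosure; apply: gorbit_refl.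
Qed.

Lemma irreducible_PermVar W : irreducible_closed W -> subs W PermVar ->
  exists i, subs W (zclosure (gorbit (Rlist i))).
Proof.
move=> irrW WX.
apply: (@irreducible_union _ (enum 'I_7) (fun i => zclosure (gorbit (Rlist i))) _ irrW).
  by move=> i; apply: zclosure_closed.
by move=> x /WX/PermVar_cover[i xi]; exists i; rewrite ?mem_enum.
Qed.

Lemma component_Rlist i : irr_component PermVar (zclosure (gorbit (Rlist i))).
Proof.
split; [exact: zclosure_PermVar|exact: irreducible_Rlist|].
move=> W irrW iW /(irreducible_PermVar irrW)[j Wj].
suff -> : i = j by [].
by apply: Rlist_sub => x /iW/Wj.
Qed.

Lemma componentP Z : irr_component PermVar Z <->
  exists i, seteq Z (zclosure (gorbit (Rlist i))).
Proof.
split=> [[ZX irrZ maxZ]|[i /sset_eq->]]; last exact: component_Rlist.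
have [i Zi] := irreducible_PermVar irrZ ZX; exists i => x; split; first exact: Zi.
by apply: maxZ => //; [apply: irreducible_Rlist|apply: zclosure_PermVar].
Qed.

Definition cut k (x : nat -> CC) i := if (i < k)%N then x i else 0.

(** The parameters are released in the order p, w1, w2, q, so that each one makes a new structure
    constant nonzero: in turn the e2-part of f1 f1, the e1-part and the e2-part of e1 e1, and the
    e1-part of f1 f1. *)
Definition odd_square_cut k (x : nat -> CC) : struct :=
  odd_square (cut k x 0) (cut k x 3) (cut k x 1) (cut k x 2).

Lemma cut_cut k x : cut k.+1 (cut k x) = cut k x.
Proof.
apply/funext => i; rewrite /cut; have [ik|_] := ltnP i k; last by rewrite if_same.
by rewrite ltnS ltnW.
Qed.

Lemma chain_RQ : irr_chain (zclosure (gorbit RQ)) 4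
  (fun k => zclosure (img (odd_square_cut k))).
Proof.
have pc k i n : (i < n)%N -> polp n (fun x => cut k x i).
  by move=> ltin; rewrite /cut; case: (i < k)%N; [apply: pp_var|apply: pp_cst].
split=> k lk.
  split.
    apply: (@irreducible_image 4); apply: polymap_mk;
      repeat first [by apply: pc | apply: pp_cst | apply: pp_opp | apply: pp_mul].
  rewrite zclosure_RQ; apply: zclosure_sub => _ [x ->]; apply: sub_zclosure.
  by exists (fun i => nth 0 [:: cut k x 0; cut k x 3; cut k x 1; cut k x 2] i).
split.
  apply: zclosure_sub => _ [x ->]; apply: sub_zclosure; exists (cut k x).
  by rewrite /odd_square_cut cut_cut.
move=> sub.
have in1 : zclosure (img (odd_square_cut k.+1)) (odd_square_cut k.+1 (fun=> 1)).
  by apply: sub_zclosure; exists (fun=> 1).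
have := sub _ in1.
have sep f : polyfun f -> (forall x, f (odd_square_cut k x) = 0) ->
    f (odd_square_cut k.+1 (fun=> 1)) * f (odd_square_cut k.+1 (fun=> 1)) = 1 ->
    ~ zclosure (img (odd_square_cut k)) (odd_square_cut k.+1 (fun=> 1)).
  move=> pf f0 f1 /(zclosure_zero pf) z; move/eqP: f1.
  by rewrite z ?mul0r 1?eq_sym ?oner_eq0 // => _ [x ->].
case: k lk {sub in1} sep => [|[|[|[|k]]]] // _ sep; [apply: (sep (fun c => c i2 i2 i1))
  |apply: (sep (fun c => c i0 i0 i0))|apply: (sep (fun c => c i0 i0 i1))
  |apply: (sep (fun c => c i2 i2 i0))]; try exact: pf_coord;
  rewrite /odd_square_cut /odd_square /mk /cut /= => *; ring.
Qed.

Lemma var_dim_PermVar : var_dim PermVar 4.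
Proof.
have no5 i : ~ exists Zs, irr_chain (zclosure (gorbit (Rlist i))) 5 Zs.
  have [phi pphi E] := Rlist_image i; apply: (no_long_chain pphi).
  by rewrite E.
split.
  have [_ _ _ R4 _] := RlistE; pose i : 'I_7 := Ordinal (isT : (3 < 7)%N).
  exists (zclosure (gorbit (Rlist i))); split; first exact: component_Rlist.
  split; last exact: no5.
  by rewrite R4; eexists; apply: chain_RQ.
move=> Z /componentP[i /sset_eq ->].
by apply: krull_dim_le => //; apply: irreducible_Rlist.
Qed.

(** A rigid c lies in the closure of some listed orbit. If the open orbit of c missed that orbit,
    the closed complement would contain it, hence also its closure and c itself. *)
Lemma rigidP c : rigid PermVar c <-> exists i, gorbit (Rlist i) c.
Proof.
split=> [[Xc [T [cT TE]]]|[i ic]]; last first.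
  split; first exact: PermVar_orbit ic.
  by rewrite -(gorbit_eq ic); apply: open_Rlist.
have [i ci] := PermVar_cover Xc; exists i; apply: contrapT => nic.
have [_] : PermVar c /\ ~ T c by apply/TE; apply: gorbit_refl.
apply; apply: ci => // d id; apply: contrapT => Td.
apply: nic; apply: (gorbit_trans id); apply: gorbit_sym; apply/TE.
by split=> //; apply: PermVar_orbit id.
Qed.

Theorem mainTheorem8 :
  var_dim PermVar 4 /\
  (forall Z, irr_component PermVar Z <->
     exists i : 'I_7, seteq Z (zclosure (gorbit (Rlist i)))) /\
  (forall i j : 'I_7, seteq (zclosure (gorbit (Rlist i))) (zclosure (gorbit (Rlist j))) -> i = j) /\
  (forall c, rigid PermVar c <-> exists i : 'I_7, gorbit (Rlist i) c).
Proof.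
split; [exact: var_dim_PermVar|split; [exact: componentP|split; [|exact: rigidP]]].
by move=> i j /sset_eq E; apply: Rlist_sub; rewrite E.
Qed.
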